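(* Let $u,d$ be positive integers with $u<d/2$ and $\gcd(u,d)=1$, let $\mathbb K$ be a field, and let $q$, $b_n,\sigma_n,\tau_n$, $m_\ell$, $\ell(n)$ be the integers attached to $(d,u)$ in the context. The minimal bigraded free resolution of $\mathrm{Rees}(\mathcal I)$ as an $S$-module is of the form $$0\to \bigoplus_{n=1}^{q-1}S\big(-(b_n,\,|\sigma_n-\tau_n|+2|\sigma_{m_{\ell(n)}}-\tau_{m_{\ell(n)}}|)\big)\xrightarrow{\Phi_3}\bigoplus_{n=1}^{q}S\big(-(b_n,\,|\sigma_n-\tau_n|+|\sigma_{m_{\ell(n)}}-\tau_{m_{\ell(n)}}|)\big)^2\xrightarrow{\Phi_2}\bigoplus_{n=1}^{q+2}S\big(-(b_n,\,|\sigma_n-\tau_n|)\big)\xrightarrow{\Phi_1}S\xrightarrow{\Phi_0}\mathrm{Rees}(\mathcal I)\to0 .$$ That is, there are $S$-linear maps $\Phi_1,\Phi_2,\Phi_3$, homogeneous of bidegree $(0,0)$, making this sequence exact, and the resolution is minimal (the matrices of $\Phi_1,\Phi_2,\Phi_3$ have all entries in the ideal $\langle T_0,T_1,X_0,X_1,X_2\rangle$).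
   Context: Setting: $R=\mathbb K[T_0,T_1]$, $S=\mathbb K[T_0,T_1,X_0,X_1,X_2]$, $\mathcal I=\langle T_0^d,\,T_0^{d-u}T_1^u,\,T_1^d\rangle\subset R$, $\mathrm{Rees}(\mathcal I)=\bigoplus_{n\ge0}\mathcal I^nZ^n\subset R[Z]$. The map $\Phi_0:S\to\mathrm{Rees}(\mathcal I)$ is the surjective $\mathbb K$-algebra morphism with $T_i\mapsto T_i$, $X_0\mapsto ZT_0^d$, $X_1\mapsto ZT_0^{d-u}T_1^u$, $X_2\mapsto ZT_1^d$; $\mathrm{Rees}(\mathcal I)$ is an $S$-module through $\Phi_0$. Bigrading: $\mathrm{bideg}(T_i)=(1,0)$, $\mathrm{bideg}(X_j)=(0,1)$, $\mathrm{bideg}(Z)=(-d,1)$, so that $\Phi_0$ is homogeneous of bidegree $(0,0)$. For $(a,b)\in\mathbb Z^2$, $S(a,b)$ is the twisted module with $S(a,b)_{(k,l)}=S_{(a+k,b+l)}$. Euclidean data: $a_0=d-u$, $a_1=u$, and for $1\le i\le p-1$, $a_{i-1}=q_ia_i+a_{i+1}$ with $q_i,a_{i+1}\in\mathbb Z$, $0\le a_{i+1}<a_i$, where $p$ is such that $a_p=0$. Put $q=\sum_{i=1}^{p-1}q_i$, $m_\ell=1+\sum_{j=1}^{\ell}q_j$ for $0\le \ell\le p-1$ (so $m_{p-1}=q+1$), and $m_p=q+2$. For $1\le n\le q$, $\ell(n)$ is the unique $\ell$ with $m_{\ell-1}\le n<m_\ell$. Slow Euclidean Remainder Sequence: $(b_1,c_1)=(d-u,u)$,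 $(\sigma_1,\tau_1,\alpha_1,\beta_1)=(0,1,1,0)$, and for $1\le n\le q$: if $b_n-c_n\ge c_n$, then $(b_{n+1},c_{n+1})=(b_n-c_n,c_n)$ and $(\sigma_{n+1},\tau_{n+1},\alpha_{n+1},\beta_{n+1})=(\sigma_n-\alpha_n,\tau_n-\beta_n,\alpha_n,\beta_n)$; if $b_n-c_n<c_n$, then $(b_{n+1},c_{n+1})=(c_n,b_n-c_n)$ and $(\sigma_{n+1},\tau_{n+1},\alpha_{n+1},\beta_{n+1})=(\alpha_n,\beta_n,\sigma_n-\alpha_n,\tau_n-\beta_n)$. One has $\sigma_nu+\tau_n(d-u)=b_n$. Finally $b_{q+2}=0$ and, by convention, $(\sigma_{q+2},\tau_{q+2})=(d-u,-u)$, so $|\sigma_{q+2}-\tau_{q+2}|=d$. *)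

(* Defs.v *)
From HB Require Import structures.
From mathcomp Require Import all_boot all_order all_algebra.
From mathcomp Require Import mpoly.

Set Implicit Arguments.
Unset Strict Implicit.
Unset Printing Implicit Defensive.

Import Order.TTheory GRing.Theory Num.Theory.
Local Open Scope ring_scope.

(* Euclidean algorithm on (d - u, u).  Since the remainders decrease strictly *)
(* as long as they are nonzero, this determines p, a 0, ..., a p and          *)
(* qs 1, ..., qs (p - 1) uniquely; other values of a and qs are irrelevant.   *)

Definition euclid_data (d u p : nat) (a qs : nat -> nat) : Prop :=
  [/\ a 0%N = (d - u)%N,
      a 1%N = u,
      (forall i : nat, (1 <= i <= p.-1)%N ->
         a i.-1 = (qs i * a i + a i.+1)%N /\ (a i.+1 < a i)%N)
    & a p = 0%N].

Definition euclid_q (p : nat) (qs : nat -> nat) : nat :=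
  (\sum_(1 <= i < p) qs i)%N.

Definition euclid_m (p : nat) (qs : nat -> nat) (l : nat) : nat :=
  if (l < p)%N then (1 + \sum_(1 <= j < l.+1) qs j)%N
  else (euclid_q p qs + 2)%N.

Definition euclid_ell (p : nat) (qs ell : nat -> nat) : Prop :=
  forall n : nat, (1 <= n <= euclid_q p qs)%N ->
    (1 <= ell n <= p)%N /\
    (euclid_m p qs (ell n).-1 <= n < euclid_m p qs (ell n))%N.

Record sers_state := SersState {
  sers_b : int; sers_c : int;
  sers_sigma : int; sers_tau : int; sers_alpha : int; sers_beta : int }.

Definition sers_step (s : sers_state) : sers_state :=
  let: SersState b c sigma tau alpha beta := s in
  if c <= b - c
  then SersState (b - c) c (sigma - alpha) (tau - beta) alpha beta
  else SersState c (b - c) alpha beta (sigma - alpha) (tau - beta).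

(* The sequence is indexed from 1; the value at n = 0 is irrelevant. *)
Definition sers (d u n : nat) : sers_state :=
  iter n.-1 sers_step (SersState (d%:Z - u%:Z) u%:Z 0 1 1 0).

(* The index q + 2 lies outside the recursion, and is set by convention. *)
Definition seq_b (d u q n : nat) : int :=
  if n == q.+2 then 0 else sers_b (sers d u n).
Definition seq_sigma (d u q n : nat) : int :=
  if n == q.+2 then d%:Z - u%:Z else sers_sigma (sers d u n).
Definition seq_tau (d u q n : nat) : int :=
  if n == q.+2 then - u%:Z else sers_tau (sers d u n).

Definition absdiff (d u q n : nat) : int :=
  `|seq_sigma d u q n - seq_tau d u q n|.

Section Ideals.

Variable A : comNzRingType.

Definition ideal_gen (k : nat) (g : 'I_k -> A) (x : A) : Prop :=
  exists c : 'I_k -> A, x = \sum_(i < k) c i * g i.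

Definition ideal_mul (I J : A -> Prop) (x : A) : Prop :=
  exists (k : nat) (f g : 'I_k -> A),
    [/\ forall i, I (f i), forall i, J (g i) & x = \sum_(i < k) f i * g i].

Definition ideal_pow (I : A -> Prop) (n : nat) : A -> Prop :=
  iter n (ideal_mul I) (fun=> True).

End Ideals.

(* R = K[T_0, T_1] and S = K[T_0, T_1, X_0, X_1, X_2]: the variables of S     *)
(* indexed by lshift 3 i are the T_i, those indexed by rshift 2 j the X_j.    *)
(* R[Z] is {poly R}.                                                          *)

Notation ringR K := {mpoly K[2]}.
Notation ringS K := {mpoly K[2 + 3]}.
Notation ringRZ K := {poly {mpoly K[2]}}.

Section Rees.

Variables (K : fieldType) (d u : nat).

Definition T0 : ringR K := 'X_(0 : 'I_2).
Definition T1 : ringR K := 'X_(1 : 'I_2).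

Definition gens (j : 'I_3) : ringR K :=
  tnth [tuple T0 ^+ d; T0 ^+ (d - u) * T1 ^+ u; T1 ^+ d] j.

Definition idealI : ringR K -> Prop := ideal_gen gens.

Definition Rees (f : ringRZ K) : Prop :=
  forall n : nat, ideal_pow idealI n f`_n.

Definition Phi0 (s : ringS K) : ringRZ K :=
  mmap (fun c : K => (c%:MP_[2])%:P)
       (fun i : 'I_(2 + 3) =>
          match split i with
          | inl i => ('X_i)%:P
          | inr j => (gens j)%:P * 'X
          end) s.

Definition Tdeg (m : 'X_{1..2 + 3}) : nat := (\sum_(i < 2) m (lshift 3 i))%N.
Definition Xdeg (m : 'X_{1..2 + 3}) : nat := (\sum_(j < 3) m (rshift 2 j))%N.

Definition S_comp (k l : int) (s : ringS K) : Prop :=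
  forall m, m \in msupp s -> (Tdeg m)%:Z = k /\ (Xdeg m)%:Z = l.

(* bideg T_i = (1, 0) and bideg Z = (- d, 1). *)
Definition RZ_comp (k l : int) (f : ringRZ K) : Prop :=
  forall (n : nat) m, m \in msupp f`_n ->
    (mdeg m)%:Z - d%:Z * n%:Z = k /\ n%:Z = l.

(* Component of bidegree (k, l) of the direct sum of the S(tw j), j < n. *)
Definition free_comp (n : nat) (tw : 'I_n -> int * int) (k l : int)
    (v : 'rV[ringS K]_n) : Prop :=
  forall j, S_comp ((tw j).1 + k) ((tw j).2 + l) (v 0 j).

Definition irrelevant : ringS K -> Prop :=
  ideal_gen (fun i : 'I_(2 + 3) => 'X_i : ringS K).

End Rees.

Definition bihomogeneous (U V : Type) (compU : int -> int -> U -> Prop)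
    (compV : int -> int -> V -> Prop) (f : U -> V) : Prop :=
  forall k l x, compU k l x -> compV k l (f x).

Definition exact_at (U : Type) (V W : nmodType) (f : U -> V) (g : V -> W) :
    Prop :=
  forall v, g v = 0 <-> exists x, f x = v.

Section Twists.

Variables (d u p : nat) (qs ell : nat -> nat).
Let q := euclid_q p qs.
Let w := absdiff d u q.
Let wm (n : nat) := w (euclid_m p qs (ell n)).

Definition twist1 (i : 'I_q.+2) : int * int :=
  let n := i.+1 in (- seq_b d u q n, - w n).

(* Coordinates 2n - 2 and 2n - 1 are the two copies of the n-th summand. *)
Definition twist2 (i : 'I_q.*2) : int * int :=
  let n := (i./2).+1 in (- seq_b d u q n, - (w n + wm n)).

Definition twist3 (i : 'I_q.-1) : int * int :=
  let n := i.+1 in (- seq_b d u q n, - (w n + 2 * wm n)).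

End Twists.

(* Main.v *)
(* The kernel of Phi0 is the lattice ideal of the vectors (sigma, tau), where  *)
(* v = (sigma, tau) of degree b = sigma u + tau (d - u) >= 0 gives a binomial *)
(*   F_v = T_0^b A - T_1^b B,   A, B monomials in the X_j,                    *)
(* and the slow Euclidean sequence lists the v whose F_v generate.  With      *)
(* v = (sigma_n, tau_n), gamma = (alpha_n, beta_n), g = v - gamma, of degrees *)
(* b, c, b - c, and F_gamma = T_0^c C - T_1^c D, F_g = T_0^(b-c) A D -        *)
(* T_1^(b-c) B C, the n-th step adds the generator F_g and the two syzygies   *)
(*   C F_v - T_1^c F_g - T_0^(b-c) A F_gamma = 0,                             *)
(*   D F_v - T_0^c F_g - T_1^(b-c) B F_gamma = 0.                             *)
(* Exactness is an iterated mapping cone: if J is the ideal of the generators *)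
(* found before the n-th step then J : F_g = (T_0^c, T_1^c).  Indeed J is     *)
(* (F_v, F_gamma) after inverting the X_j, D F_v = T_0^c F_g mod F_gamma, and *)
(* F_g is a nonzerodivisor mod F_gamma.  The Koszul relation of F_v, F_gamma  *)
(* is a combination of the two syzygies of step n and also, up to sign, of    *)
(* the two syzygies of step n - 1; this gives one second syzygy for each pair *)
(* of consecutive steps.  Finally every lattice vector of nonnegative degree  *)
(* is a sign-compatible sum of generating vectors, by descending induction on *)
(* the cones spanned by the pairs (v, gamma).                                 *)

Require Import Defs.
From HB Require Import structures.
From mathcomp Require Import all_boot all_order all_algebra.
From mathcomp Require Import mpoly.
From mathcomp Require Import zify ring.
Import Order.TTheory GRing.Theory Num.Theory.
Local Open Scope ring_scope.

Set Implicit Arguments.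
Unset Strict Implicit.
Unset Printing Implicit Defensive.

(** * Polynomials in one distinguished variable *)

(** Generation of the kernel. [Phi0] sends monomials to monomials, so its kernel is spanned by
    differences of monomials with equal image ([Phi0_kernel_binomials]). Each such difference is a
    multiple of one F_v, or a sum of two such multiples, with v of nonnegative degree
    ([mon5_ideal]). The binomial of a sum of equally oriented vectors is a combination of the
    binomials of the summands ([binomD]), and [cone_ideal] decomposes every v of nonnegative degree
    along the slow sequence without sign cancellation. So the q + 2 listed binomials generate the
    kernel ([Phi0_kernel]).

    Exactness. In the code step k, with k < q, is step n = k + 1 of the statement. Adding F_g to the
    ideal J already built costs the resolution of R / (J : F_g), and J : F_g = (T_0^c, T_1^c) is
    resolved by a Koszul complex: two new syzygies and one new second syzygy. The colon ideal is
    computed in [stage_colon] from [stage_local], [binom_regular] and [xmon_saturated];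
    [stage_exact] and [phi2_exact_below] are the two levels of the mapping cone, and [phi3_inj]
    holds because [phi3] is triangular. The process starts with F_v, F_gamma for v = (0, 1), gamma =
    (1, 0), whose only relation is the Koszul one. That relation is a combination of the two
    syzygies of step 0, so it is not a separate generator and it absorbs the second syzygy of step
    0. This explains the ranks q + 2, 2q and q - 1.

    Degrees and minimality. A swap of the slow sequence occurs exactly at the end of a block of
    equal Euclidean divisors ([slow_in_block]), so gamma of step n is the generator of index
    m_(ell(n)) ([vecs_c], [euclid_m_mu]); this gives the twists. Every nonzero entry of the matrices
    has a factor that is a power T_i^c with c > 0 or an X-monomial of positive degree, or is a
    binomial of positive X-degree. *)

Section PolyIdomain.
Variable A : idomainType.
Implicit Types p q g : {poly A}.

Lemma polyX_mulr_inj p q : p * 'X = q * 'X -> p = q.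
Proof. by apply: mulIf; rewrite polyX_eq0. Qed.

Lemma polyX_split p : exists p', p = p' * 'X + p.[0]%:P.
Proof.
have /factor_theorem [p' Ep] : root (p - p.[0]%:P) 0.
  by rewrite /root hornerD hornerN hornerC subrr.
by exists p'; rewrite subr0 in Ep; rewrite -Ep subrK.
Qed.

Lemma polyX_cancel p q g :
  g.[0] != 0 -> p * 'X = q * g -> exists q', p = q' * g.
Proof.
move=> g0 E; have q0 : q.[0] = 0.
  have /eqP := congr1 (horner^~ 0) E.
  by rewrite /= !hornerM hornerX mulr0 eq_sym mulf_eq0 (negPf g0) orbF => /eqP.
have [q' Eq] := polyX_split q; rewrite q0 addr0 in Eq.
by exists q'; apply: polyX_mulr_inj; rewrite E Eq mulrAC.
Qed.

Lemma polyX_saturated p a b (g h : A) :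
  p * 'X = a * g%:P + b * h%:P -> exists a' b', p = a' * g%:P + b' * h%:P.
Proof.
move=> E; have E0 : a.[0] * g + b.[0] * h = 0.
  have := congr1 (horner^~ 0) E.
  by rewrite /= hornerD !hornerM !hornerC hornerX mulr0 => /esym.
have [[a' Ea] [b' Eb]] := (polyX_split a, polyX_split b).
exists a', b'; apply: polyX_mulr_inj; rewrite E Ea Eb !mulrDl addrACA.
by rewrite -!polyCM -polyCD E0 addr0 !(mulrAC _ 'X).
Qed.

(** Once [a] is inverted the divisor is monic up to a unit, remainders of degree less than [c] are
    unique, and a nonzero constant is a nonzerodivisor on them. The power of [a] clears the
    denominators. *)
Lemma poly_cancel_constant c (a b e : A) f h :
  (0 < c)%N -> a != 0 -> e != 0 ->
  e%:P * f = h * ('X^c * a%:P - b%:P) ->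
  exists N h', (a ^+ N)%:P * f = h' * ('X^c * a%:P - b%:P).
Proof.
move=> c0 a0 e0 E; set G := (_ - _) in E *.
have EG : G = a *: 'X^c - b%:P by rewrite /G mulrC mul_polyC.
have sG : size G = c.+1.
  rewrite EG size_polyDl ?size_scale ?size_polyXn //.
  by rewrite size_polyN (leq_ltn_trans (size_polyC_leq1 _)).
have lG : lead_coef G = a.
  rewrite EG lead_coefDl ?lead_coefZ ?lead_coefXn ?mulr1 //.
  by rewrite size_polyN size_scale // size_polyXn (leq_ltn_trans (size_polyC_leq1 _)).
have Gn0 : G != 0 by rewrite -size_poly_eq0 sG.
(* Pseudo-division by G leaves a remainder of degree < c, and e times it is   *)
(* still a multiple of G, so it vanishes.                                     *)
have D := Pdiv.Idomain.divp_eq f G.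
have rs : (size (f %% G)%R < size G)%N by rewrite ltn_modp.
move: D rs; set N := Pdiv.Idomain.scalp _ _; set r := modp _ _; set k := divp _ _ => D rs.
rewrite lG in D.
exists N, k; suff r0 : r = 0 by rewrite mul_polyC D r0 addr0.
have Er : e *: r = ((a ^+ N)%:P * h - e%:P * k) * G.
  rewrite mulrBl -!mulrA -E [(a ^+ N)%:P * _]mulrCA [_ * f]mul_polyC D mulrDr.
  by rewrite addrC addKr mul_polyC.
move: Er; case: (eqVneq ((a ^+ N)%:P * h - e%:P * k) 0) => [->|l0 Er].
  by rewrite mul0r -mul_polyC => /eqP; rewrite mulf_eq0 polyC_eq0 (negPf e0) => /eqP.
have := rs; rewrite -(size_scale r e0) Er size_mul // sG.
by rewrite addnS /= ltnNge -add1n leq_add2r lt0n size_poly_eq0 l0.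
Qed.

End PolyIdomain.

Section OneVariable.
Variables (K : fieldType) (n : nat) (i : 'I_n).
Implicit Types f g h : {mpoly K[n]}.

Fact univ_key : unit. Proof. by []. Qed.
(** Coefficients stay in the full ring, although ['X_i] does not occur in them; thus [univ f = f%:P]
    expresses that [f] is free of ['X_i], and evaluation at ['X_i] is a left inverse ([univK]). *)
Definition univ : {mpoly K[n]} -> {poly {mpoly K[n]}} := locked_with univ_key
  (mmap (polyC \o @mpolyC n K) (fun j => if j == i then 'X else ('X_j)%:P)).

Fact univ_is_zmod_morphism : zmod_morphism univ.
Proof. by move=> f g; rewrite /univ unlock rmorphB. Qed.

Fact univ_is_monoid_morphism : monoid_morphism univ.
Proof. by split=> [|f g]; rewrite /univ unlock ?rmorph1 ?rmorphM. Qed.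

HB.instance Definition _ := GRing.isZmodMorphism.Build
  {mpoly K[n]} {poly {mpoly K[n]}} univ univ_is_zmod_morphism.
HB.instance Definition _ := GRing.isMonoidMorphism.Build
  {mpoly K[n]} {poly {mpoly K[n]}} univ univ_is_monoid_morphism.

Lemma univX : univ 'X_i = 'X.
Proof. by rewrite /univ unlock /= mmapX mmap1U eqxx. Qed.

Lemma univXneq j : j != i -> univ 'X_j = ('X_j)%:P.
Proof. by move=> ji; rewrite /univ unlock /= mmapX mmap1U (negbTE ji). Qed.

Lemma univM f g : univ (f * g) = univ f * univ g.
Proof. exact: rmorphM. Qed.

Lemma univD f g : univ (f + g) = univ f + univ g.
Proof. exact: rmorphD. Qed.

Lemma univB f g : univ (f - g) = univ f - univ g.
Proof. exact: rmorphB. Qed.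

Lemma univXn f k : univ (f ^+ k) = univ f ^+ k.
Proof. exact: rmorphXn. Qed.

Lemma univK f : (univ f).['X_i] = f.
Proof.
rewrite /univ unlock /mmap horner_sum [RHS]mpolyE; apply: eq_bigr => m _.
rewrite hornerM hornerC /= mul_mpolyC; apply: (congr1 (fun x => _ *: x)).
rewrite /mmap1 horner_prod [RHS]mpolyXE_id; apply: eq_bigr => j _.
by rewrite horner_exp; case: eqP => [->|_]; rewrite ?hornerX ?hornerC.
Qed.

Definition at0 f : {mpoly K[n]} := (univ f).[0].

Lemma at0X : at0 'X_i = 0.
Proof. by rewrite /at0 univX hornerX. Qed.

Lemma at0_const f : univ f = f%:P -> at0 f = f.
Proof. by rewrite /at0 => ->; rewrite hornerC. Qed.

Lemma at0M f g : at0 (f * g) = at0 f * at0 g.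
Proof. by rewrite /at0 univM hornerM. Qed.

Lemma at0B f g : at0 (f - g) = at0 f - at0 g.
Proof. by rewrite /at0 univB hornerD hornerN. Qed.

Lemma at0Xn f k : at0 (f ^+ k) = at0 f ^+ k.
Proof. by rewrite /at0 univXn horner_exp. Qed.

Lemma at0_0 : at0 0 = 0.
Proof. by rewrite /at0 rmorph0 horner0. Qed.

Lemma cancel_var f g h :
  at0 g != 0 -> 'X_i * f = h * g -> exists h', f = h' * g.
Proof.
move=> g0 /(congr1 univ); rewrite !univM univX mulrC.
case/(polyX_cancel g0) => h' E; exists h'.['X_i].
by rewrite -[LHS]univK E hornerM univK.
Qed.

Lemma cancel_varX k f g h :
  at0 g != 0 -> 'X_i ^+ k * f = h * g -> exists h', f = h' * g.
Proof.
move=> g0; elim: k f h => [|k IH] f h; first by rewrite mul1r; exists h.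
rewrite exprSr -mulrA => /IH [h' /(cancel_var g0) [h'' ->]].
by exists h''.
Qed.

Lemma saturated_var f g h a b :
  univ g = g%:P -> univ h = h%:P ->
  'X_i * f = a * g + b * h -> exists a' b', f = a' * g + b' * h.
Proof.
move=> Eg Eh /(congr1 univ).
rewrite univD !univM univX mulrC Eg Eh => /polyX_saturated [a' [b' E]].
exists a'.['X_i], b'.['X_i].
by rewrite -[LHS]univK E hornerD !hornerM !hornerC.
Qed.

Lemma cancel_constant c (a b e f h : {mpoly K[n]}) :
  (0 < c)%N -> a != 0 -> e != 0 ->
  univ a = a%:P -> univ b = b%:P -> univ e = e%:P ->
  e * f = h * ('X_i ^+ c * a - b) ->
  exists N h', a ^+ N * f = h' * ('X_i ^+ c * a - b).
Proof.
move=> c0 a0 e0 Ea Eb Ee /(congr1 univ).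
have EG : univ ('X_i ^+ c * a - b) = 'X^c * a%:P - b%:P.
  by rewrite univB univM univXn univX Ea Eb.
rewrite [univ (e * f)]univM [univ (h * _)]univM EG Ee.
case/(poly_cancel_constant c0 a0 e0) => N [k E]; exists N, k.['X_i].
by rewrite -[a ^+ N * f]univK [univ _]univM univXn Ea -polyC_exp E -EG hornerM univK.
Qed.

End OneVariable.

(** * Binomials *)

Section Binomials.
Variable K : fieldType.
Local Notation S := (ringS K).

Definition tv (i : 'I_2) : S := 'X_(lshift 3 i).
Definition xv (j : 'I_3) : S := 'X_(rshift 2 j).
Local Notation t0 := (tv 0).
Local Notation t1 := (tv 1).

(** A lattice vector (sigma, tau) of the sequence has entries of opposite weak signs, so it is
    stored as [s] = |sigma|, [t] = |tau| and an orientation [o], true for sigma <= 0 <= tau.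
    Reversing the orientation exchanges the two X-monomials of [binom]; the X-degree is [s + t] =
    |sigma - tau|. *)
Definition xmon (o : bool) (s t : nat) : S :=
  if o then xv 0 ^+ s * xv 2 ^+ t else xv 1 ^+ (s + t).

Definition binom (o : bool) (b s t : nat) : S :=
  t0 ^+ b * xmon o s t - t1 ^+ b * xmon (~~ o) s t.

Lemma tv_neq0 i : tv i != 0.
Proof. by rewrite -msupp_eq0 msuppX. Qed.

Lemma xv_neq0 j : xv j != 0.
Proof. by rewrite -msupp_eq0 msuppX. Qed.

Lemma xmon_neq0 o s t : xmon o s t != 0.
Proof. by rewrite /xmon; case: o; rewrite ?mulf_neq0 ?expf_neq0 ?xv_neq0. Qed.

Lemma xmonD o s t s' t' : xmon o (s + s') (t + t') = xmon o s t * xmon o s' t'.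
Proof.
rewrite /xmon; case: o; first by rewrite [_ ^+ (s + _)]exprD [_ ^+ (t + _)]exprD mulrACA.
by rewrite addnACA exprD.
Qed.

Lemma xmonX o s t N : xmon o (s * N) (t * N) = xmon o s t ^+ N.
Proof.
rewrite /xmon; case: o; first by rewrite [_ ^+ (s * _)]exprM [_ ^+ (t * _)]exprM exprMn.
by rewrite -mulnDl exprM.
Qed.

Lemma univ_tx i j : univ (lshift 3 i) (xv j) = (xv j)%:P.
Proof. by rewrite univXneq // eq_rlshift. Qed.

Lemma univ_tt i j : i != j -> univ (lshift 3 i) (tv j) = (tv j)%:P.
Proof. by move=> ij; rewrite univXneq // eq_lshift eq_sym. Qed.

Lemma univ_xt i j : univ (rshift 2 j) (tv i) = (tv i)%:P.
Proof. by rewrite univXneq // eq_lrshift. Qed.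

Lemma at0_xx j k : at0 (rshift 2 j) (xv k) = if k == j then 0 else xv k.
Proof.
case: eqP => [->|/eqP kj]; first exact: at0X.
by rewrite at0_const // univXneq // eq_rshift.
Qed.

Lemma univ_t_xmon i o s t : univ (lshift 3 i) (xmon o s t) = (xmon o s t)%:P.
Proof.
rewrite /xmon; case: o; last by rewrite univXn univ_tx polyC_exp.
by rewrite univM !univXn !univ_tx polyCM !polyC_exp.
Qed.

Lemma at0_xmon j o s t : at0 (rshift 2 j) (xmon o s t) =
  let x k := if k == j then 0 else xv k in
  if o then x 0 ^+ s * x 2 ^+ t else x 1 ^+ (s + t).
Proof.
rewrite /xmon /=; case: o; last by rewrite at0Xn at0_xx.
by rewrite at0M !at0Xn !at0_xx.
Qed.

Lemma tdiff_neq0 c (p q : S) : (0 < c)%N -> univ (lshift 3 0) q = q%:P ->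
  (p != 0) || (q != 0) -> t0 ^+ c * p - t1 ^+ c * q != 0.
Proof.
move=> c0 Eq; case: (eqVneq q 0) => [->|q0 _].
  by rewrite orbF mulr0 subr0 => p0; rewrite mulf_neq0 ?expf_neq0 ?tv_neq0.
apply/eqP => /(congr1 (at0 (lshift 3 0))).
rewrite at0B !at0M !at0Xn at0X (at0_const Eq) (at0_const (univ_tt _)) //.
rewrite expr0n gtn_eqF // mul0r add0r at0_0 => /eqP.
by rewrite oppr_eq0 mulf_eq0 (negPf q0) orbF expf_eq0 (negPf (tv_neq0 _)) andbF.
Qed.

(** The two terms have no x_j in common, so at most one of them vanishes at x_j = 0. Hence each x_j
    can be cancelled modulo a binomial. *)
Lemma binom_at0 j o c s t : (0 < c)%N -> (0 < s + t)%N ->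
  at0 (rshift 2 j) (binom o c s t) != 0.
Proof.
move=> c0 st0; rewrite at0B !at0M !at0Xn !(at0_const (univ_xt _ _)).
have C k : univ (lshift 3 0) (if k == j then 0 else xv k) =
    (if k == j then 0 else xv k : S)%:P.
  by case: ifP; rewrite ?univ_tx ?rmorph0.
rewrite !at0_xmon /=; apply: tdiff_neq0 => //.
  case: o => /=; first by rewrite univXn C polyC_exp.
  by rewrite univM !univXn !C polyCM !polyC_exp.
have E k m : ((if k == j then 0 else xv k : S) ^+ m == 0) = (k == j) && (0 < m)%N.
  by rewrite expf_eq0; case: (k == j); rewrite ?eqxx ?andbT ?(negPf (xv_neq0 _)) ?andbF.
case: o; rewrite !mulf_eq0 !E /=;
  by case: j {E C} => [[|[|[|j]]]] //= lj; rewrite ?st0 ?orbT ?andbF.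
Qed.

Lemma xmon_cancel_binom o' m n o c s t f h : (0 < c)%N -> (0 < s + t)%N ->
  xmon o' m n * f = h * binom o c s t -> exists h', f = h' * binom o c s t.
Proof.
move=> c0 st0; have B j := binom_at0 j o c0 st0.
rewrite /xmon; case: o'; last exact: cancel_varX (B 1).
by rewrite -mulrA => /(cancel_varX (B _)) [h' /(cancel_varX (B _))].
Qed.

Lemma xmon_diff_neq0 o m n : (0 < m + n)%N -> xmon o m n - xmon (~~ o) m n != 0.
Proof.
move=> mn0; apply/eqP => /(congr1 (at0 (rshift 2 1))).
rewrite at0B !at0_xmon at0_0 /=.
case: o => /=; rewrite expr0n gtn_eqF //= ?subr0 ?add0r => /eqP;
  by rewrite ?oppr_eq0; apply/negP; rewrite ?mulf_neq0 ?expf_neq0 ?xv_neq0.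
Qed.

(* Eliminating [t0] from the two binomials leaves a power of [t1] times a     *)
(* nonzero polynomial in the [x_j], which is a nonzerodivisor modulo the      *)
(* second binomial.                                                           *)
Lemma binom_regular o b s t c s' t' f h :
  (0 < c)%N -> (0 < s + t)%N -> (0 < s' + t')%N ->
  f * binom o b s t = h * binom (~~ o) c s' t' ->
  exists h', f = h' * binom (~~ o) c s' t'.
Proof.
move=> c0 st0 st'0 E.
set F := binom (~~ o) c s' t' in E *.
pose A := xmon o s t; pose B := xmon (~~ o) s t.
pose C := xmon (~~ o) s' t'; pose D := xmon o s' t'.
have EF : F = t0 ^+ c * C - t1 ^+ c * D by rewrite /F /binom negbK.
(* The combination C^b ((t0^b A)^c - (t1^b B)^c) - A^c ((t0^c C)^b - (t1^c D)^b) equals t1^(bc) e.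
   Since the orientations are opposite, A and D lie on one side and B and C on the other, so the two
   terms of [e] are distinct monomials. *)
pose e := D ^+ b * A ^+ c - C ^+ b * B ^+ c.
have e0 : e != 0.
  rewrite /e -!xmonX -!xmonD; apply: xmon_diff_neq0.
  by rewrite addnACA -!mulnDl addn_gt0 !muln_gt0 st0 c0 orbT.
have [G' EG] : exists G', (t0 ^+ b * A) ^+ c - (t1 ^+ b * B) ^+ c = binom o b s t * G'.
  by rewrite subrXX; eexists.
have [F' EF'] : exists F', (t0 ^+ c * C) ^+ b - (t1 ^+ c * D) ^+ b = F * F'.
  by rewrite EF subrXX; eexists.
have Ee : (t1 ^+ (b * c) * e) * f = (C ^+ b * G' * h - A ^+ c * F' * f) * F.
  have -> : (C ^+ b * G' * h - A ^+ c * F' * f) * F =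
      C ^+ b * G' * (h * F) - A ^+ c * f * (F * F') by ring.
  rewrite -E; have -> : C ^+ b * G' * (f * binom o b s t) =
      C ^+ b * f * (binom o b s t * G') by ring.
  rewrite -EG -EF' /e !exprMn -!exprM [(c * b)%N]mulnC; ring.
rewrite EF in Ee; have [|||||N [h']] := cancel_constant c0 _ _ _ _ _ Ee.
- exact: xmon_neq0.
- by rewrite mulf_neq0 // expf_neq0 // tv_neq0.
- exact: univ_t_xmon.
- by rewrite univM univXn univ_tt // univ_t_xmon -polyC_exp -polyCM.
- rewrite univM univB !univM !univXn univ_tt // !univ_t_xmon.
  by rewrite -!polyC_exp -!polyCM -polyCB -polyCM.
by rewrite -EF -xmonX => /xmon_cancel_binom; apply.
Qed.

Lemma tpow_syzygy c f g : f * t0 ^+ c + g * t1 ^+ c = 0 ->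
  exists k, f = k * t1 ^+ c /\ g = - (k * t0 ^+ c).
Proof.
move=> E; have : t0 ^+ c * f = - g * t1 ^+ c.
  by apply/eqP; rewrite mulNr -addr_eq0 mulrC E.
case/cancel_varX => [|k Ek].
  by rewrite at0Xn at0_const ?univ_tt // expf_neq0 // tv_neq0.
exists k; split=> //; apply: (mulIf (expf_neq0 c (tv_neq0 1))).
by apply/eqP; rewrite mulNr -addr_eq0 mulrAC -Ek addrC E.
Qed.

(** The ideal (t0^c, t1^c) is extended from K[t0, t1], so every x_j is a nonzerodivisor modulo
    it. *)
Lemma xmon_saturated o m n c f a b :
  xmon o m n * f = a * t0 ^+ c + b * t1 ^+ c ->
  exists a' b', f = a' * t0 ^+ c + b' * t1 ^+ c.
Proof.
have sat j k g a' b' : xv j ^+ k * g = a' * t0 ^+ c + b' * t1 ^+ c ->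
    exists a' b', g = a' * t0 ^+ c + b' * t1 ^+ c.
  elim: k g a' b' => [|k IH] g a' b'; first by rewrite mul1r; exists a', b'.
  rewrite exprSr -mulrA => /IH [a'' [b'']].
  by apply: saturated_var; rewrite univXn univ_xt -polyC_exp.
rewrite /xmon; case: o => [|/sat//].
by rewrite -mulrA => /sat [a' [b' /sat]].
Qed.

End Binomials.

(** * An abstract tower of mapping cones *)

Section Coordinates.
Variable R : comNzRingType.

(** Indexing by natural numbers, with value 0 out of range, lets the positions [mu k] and [kappa k]
    be used without ordinal proofs. *)
Definition entry n (v : 'rV[R]_n) (i : nat) : R :=
  \sum_(j < n | j == i :> nat) v 0 j.

Definition evec n (i : nat) : 'rV[R]_n := \row_j (j == i :> nat)%:R.

Definition lincomb n (V : lmodType R) (f : nat -> V) (v : 'rV[R]_n) : V :=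
  \sum_(j < n) v 0 j *: f j.

Fact lincomb_is_linear n (V : lmodType R) f : linear (@lincomb n V f).
Proof.
move=> a u v; rewrite /lincomb scaler_sumr -big_split /=.
by apply: eq_bigr => j _; rewrite !mxE scalerDl scalerA.
Qed.

HB.instance Definition _ n (V : lmodType R) f :=
  GRing.isLinear.Build R 'rV[R]_n V _ (@lincomb n V f) (@lincomb_is_linear n V f).

Lemma entry_ord n (v : 'rV[R]_n) (j : 'I_n) : entry v j = v 0 j.
Proof. by rewrite /entry (big_pred1 j). Qed.

Lemma entry_ge n (v : 'rV[R]_n) i : (n <= i)%N -> entry v i = 0.
Proof. by move=> le_n_i; rewrite /entry big1 // => j /eqP Ej; have := ltn_ord j; lia. Qed.

Lemma entryP n (u v : 'rV[R]_n) : (forall i, entry u i = entry v i) -> u = v.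
Proof. by move=> E; apply/rowP => j; rewrite -!entry_ord. Qed.

Lemma entryD n (u v : 'rV[R]_n) i : entry (u + v) i = entry u i + entry v i.
Proof. by rewrite /entry -big_split; apply: eq_bigr => j _; rewrite mxE. Qed.

Lemma entryZ n a (v : 'rV[R]_n) i : entry (a *: v) i = a * entry v i.
Proof. by rewrite /entry mulr_sumr; apply: eq_bigr => j _; rewrite mxE. Qed.

Lemma entryB n (u v : 'rV[R]_n) i : entry (u - v) i = entry u i - entry v i.
Proof. by rewrite entryD -scaleN1r entryZ mulN1r. Qed.

Lemma entry0 n i : entry (0 : 'rV[R]_n) i = 0.
Proof. by rewrite -(scale0r 0) entryZ mul0r. Qed.

Lemma entry_evec n i j : (i < n)%N -> entry (evec n i) j = (i == j)%:R.
Proof.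
move=> lt_i; case: (ltnP j n) => [lt_j|le_j]; last first.
  by rewrite entry_ge //; case: eqP => // E; lia.
by rewrite -[j]/(val (Ordinal lt_j)) entry_ord mxE /= eq_sym.
Qed.

Lemma lincomb_evec n (V : lmodType R) (f : nat -> V) i : (i < n)%N -> lincomb f (evec n i) = f i.
Proof.
move=> lt_i; rewrite /lincomb (bigD1 (Ordinal lt_i)) //= mxE eqxx scale1r big1 ?addr0 //.
by move=> j; rewrite -val_eqE /= mxE => /negPf ->; rewrite scale0r.
Qed.

Lemma lincomb_entry n (V : lmodType R) (f : nat -> V) (v : 'rV[R]_n) :
  lincomb f v = \sum_(i < n) entry v i *: f i.
Proof. by apply: eq_bigr => j _; rewrite entry_ord. Qed.

Lemma entry_lincomb m n (f : nat -> 'rV[R]_n) (v : 'rV[R]_m) i :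
  entry (lincomb f v) i = \sum_(j < m) entry v j * entry (f j) i.
Proof.
rewrite lincomb_entry (big_morph (fun v => entry v i) (fun u v => entryD u v i) (entry0 _ i)).
by apply: eq_bigr => j _; rewrite entryZ.
Qed.

Lemma lincomb_comp m n (V : lmodType R) (f : nat -> 'rV[R]_n) (g : nat -> V) (v : 'rV[R]_m) :
  (forall i, (i < m)%N -> lincomb g (f i) = 0) -> lincomb g (lincomb f v) = 0.
Proof.
move=> f0; rewrite [lincomb f v]/lincomb linear_sum big1 // => j _.
by rewrite linearZ /= f0 ?scaler0.
Qed.

End Coordinates.

(** * Where the vectors of a step occur in the list of generators *)

Section Positions.
Variables (X : Type) (q : nat) (swap : nat -> bool) (mu : nat -> nat).
Variables fv fc fd : nat -> X.
Hypothesis mu_q : mu q = q.+1.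
Hypothesis step : forall k, (k < q)%N ->
  if swap k then [/\ fv k.+1 = fc k, fc k.+1 = fd k & mu k = k.+1]
  else [/\ fv k.+1 = fd k, fc k.+1 = fc k & mu k = mu k.+1].

(* The three vectors v, gamma and v - gamma of the k-th step sit at the       *)
(* positions k, mu k and kappa k of the list of generators.                   *)
Definition kappa k := if swap k then mu k.+1 else k.+1.
Definition gen i := if i == q.+1 then fc q else fv i.

Lemma gen_lt k : (k <= q)%N -> gen k = fv k.
Proof. by rewrite /gen; case: eqP => // ->; rewrite ltnn. Qed.

(** Descending induction from [mu q = q.+1]: [fc k] is carried along until the next swap, where it
    becomes [fv]. The type [X] is arbitrary because positions are needed both for the polynomials
    and for their lattice vectors. *)
Lemma gen_mu k : (k <= q)%N -> gen (mu k) = fc k.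
Proof.
have H i : forall k, (k + i = q)%N -> gen (mu k) = fc k.
  elim: i => [|i IH] {}k Ek; first by rewrite -[k]addn0 Ek mu_q /gen eqxx.
  have lt_k : (k < q)%N by rewrite -Ek -addSnnS leq_addr.
  have IHk : gen (mu k.+1) = fc k.+1 by apply: IH; rewrite addSnnS.
  have := step lt_k; case: ifP => _; last by case=> _ <- ->.
  by case=> E1 _ ->; rewrite -E1 gen_lt.
by move=> le_k; apply: (H (q - k)%N); rewrite subnKC.
Qed.

Lemma gen_kappa k : (k < q)%N -> gen (kappa k) = fd k.
Proof.
move=> lt_k; rewrite /kappa; have := step lt_k; case: ifP => _.
  by case=> _ <- _; rewrite gen_mu.
by case=> <- _ _; rewrite gen_lt.
Qed.

Hypothesis mu_gt : forall k, (k < q)%N -> (k < mu k <= q)%N.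

Lemma mu_bound k : (k <= q)%N -> (k < mu k <= q.+1)%N.
Proof.
rewrite leq_eqVlt => /predU1P [->|/mu_gt]; first by rewrite mu_q !leqnn.
by case/andP=> -> /leqW.
Qed.

Lemma kappa_bound k : (k < q)%N -> (k.+1 <= kappa k <= q.+1)%N.
Proof.
move=> lt_k; rewrite /kappa; case: (swap k); last by rewrite leqnn ltnW.
by case/andP: (mu_bound lt_k) => /ltnW -> ->.
Qed.

End Positions.

(** * Exactness of the iterated mapping cone *)

Section Tower.
Variables (R : idomainType) (q : nat) (T0 T1 : R).
Variables (b c : nat -> nat) (A B C D : nat -> R).
Variables (swap : nat -> bool) (mu : nat -> nat).

Definition Fv k := T0 ^+ b k * A k - T1 ^+ b k * B k.
Definition Fc k := T0 ^+ c k * C k - T1 ^+ c k * D k.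
Definition Fd k := T0 ^+ (b k - c k) * (A k * D k) - T1 ^+ (b k - c k) * (B k * C k).

Hypothesis q_gt0 : (0 < q)%N.
Hypotheses (T0_neq0 : T0 != 0) (T1_neq0 : T1 != 0).
Hypothesis bc : forall k, (k < q)%N -> (c k <= b k)%N.
Hypothesis step : forall k, (k < q)%N ->
  if swap k then [/\ Fv k.+1 = Fc k, Fc k.+1 = Fd k & mu k = k.+1]
  else [/\ Fv k.+1 = Fd k, Fc k.+1 = Fc k & mu k = mu k.+1].
Hypothesis mu_q : mu q = q.+1.
Hypothesis mu_gt : forall k, (k < q)%N -> (k < mu k <= q)%N.

(** That is, [m] is a nonzerodivisor modulo (T0^k, T1^k) for every [k]; this plays the role of
    inverting the x_j. *)
Definition saturating m := forall k f a a', m * f = a * T0 ^+ k + a' * T1 ^+ k ->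
  exists d d', f = d * T0 ^+ k + d' * T1 ^+ k.

Hypothesis saturating_D : forall k, saturating (D k).
Hypothesis regular : forall k f g, f * T0 ^+ k + g * T1 ^+ k = 0 ->
  exists h, f = h * T1 ^+ k /\ g = - (h * T0 ^+ k).
Hypothesis Fd_regular : forall k f h, (k < q)%N ->
  f * Fd k = h * Fc k -> exists h', f = h' * Fc k.
Hypothesis Fv0_regular : forall f h, f * Fv 0 = h * Fc 0 -> exists h', f = h' * Fc 0.
Hypothesis Fc0_neq0 : Fc 0 != 0.

Local Notation kappa := (kappa swap mu).
Local Notation gen := (gen q Fv Fc).

Local Notation V1 := 'rV[R]_q.+2.
Local Notation V2 := 'rV[R]_q.*2.
Local Notation V3 := 'rV[R]_q.-1.
Local Notation e := (evec R q.+2).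
Local Notation u0 k := (evec R q.*2 k.*2).
Local Notation u1 k := (evec R q.*2 k.*2.+1).

Definition syz (j : nat) : V1 :=
  let k := j./2 in
  if odd j then
    D k *: e k - T0 ^+ c k *: e (kappa k) - (T1 ^+ (b k - c k) * B k) *: e (mu k)
  else
    C k *: e k - T1 ^+ c k *: e (kappa k) - (T0 ^+ (b k - c k) * A k) *: e (mu k).

(** The difference of the two lifts [kpre k.+1] and [dpre k] of one Koszul relation. The sign
    appears because a swap exchanges the two members of the pair. *)
Definition ssyz (k : nat) : V2 :=
  T0 ^+ c k.+1 *: u0 k.+1 - T1 ^+ c k.+1 *: u1 k.+1
  - (-1) ^+ swap k *: (D k *: u0 k - C k *: u1 k).

Local Notation phi1 := (@lincomb R q.+2 R^o gen).
Local Notation phi2 := (@lincomb R q.*2 V1 syz).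
Local Notation phi3 := (@lincomb R q.-1 V2 ssyz).

Lemma gen_Fv k : (k <= q)%N -> gen k = Fv k.
Proof. exact: gen_lt. Qed.

Lemma gen_mu_Fc k : (k <= q)%N -> gen (mu k) = Fc k.
Proof. exact: gen_mu mu_q step k. Qed.

Lemma gen_kappa_Fd k : (k < q)%N -> gen (kappa k) = Fd k.
Proof. exact: gen_kappa mu_q step k. Qed.

Lemma saturatingM x y : saturating x -> saturating y -> saturating (x * y).
Proof.
by move=> Hx Hy k f a a'; rewrite -mulrA => /Hx [d [d']]; apply: Hy.
Qed.

Lemma phi1_e i : (i < q.+2)%N -> phi1 (e i) = gen i.
Proof. exact: lincomb_evec. Qed.

Lemma phi1_comb i j l x y z : (i < q.+2)%N -> (j < q.+2)%N -> (l < q.+2)%N ->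
  phi1 (x *: e i - y *: e j - z *: e l) = x * gen i - y * gen j - z * gen l.
Proof. by move=> hi hj hl; rewrite !linearB !linearZ /= !phi1_e // !scalerN. Qed.

Lemma half_lt j : (j < q.*2)%N -> (j./2 < q)%N.
Proof. by rewrite ltn_half_double. Qed.

Lemma phi1_syz j : (j < q.*2)%N -> phi1 (syz j) = 0.
Proof.
move=> /half_lt lt_k; rewrite /syz; set k := j./2 in lt_k *.
have [/andP [k_mu mu_q'] /andP [_ ka_q]] :=
  (mu_bound mu_q mu_gt (ltnW lt_k), kappa_bound swap mu_q mu_gt lt_k).
have lt_k2 : (k < q.+2)%N by rewrite ltnW // ltnW // ltnW.
have ET T : T ^+ b k = T ^+ (b k - c k) * T ^+ c k :> R by rewrite -exprD subnK ?bc.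
by case: ifP => _; rewrite phi1_comb // gen_kappa_Fd // gen_mu_Fc ?(ltnW lt_k) //
  gen_Fv ?(ltnW lt_k) // /Fv /Fc /Fd !ET; ring.
Qed.

Lemma phi12 w : phi1 (phi2 w) = 0.
Proof. by apply: lincomb_comp => j; apply: phi1_syz. Qed.

Definition koszul k : V1 := Fc k *: e k - Fv k *: e (mu k).
(** [kpre k] lifts the Koszul relation of ([Fv k], [Fc k]) through [phi2], and [dpre k] lifts that
    of ([Fd k], [Fc k]), which is the pair of step [k.+1] up to order. *)
Definition kpre k : V2 := T0 ^+ c k *: u0 k - T1 ^+ c k *: u1 k.
Definition dpre k : V2 := D k *: u0 k - C k *: u1 k.

Lemma phi2_u0 k : (k < q)%N -> phi2 (u0 k) = syz k.*2.
Proof. by move=> lt_k; rewrite lincomb_evec // ltn_double. Qed.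

Lemma phi2_u1 k : (k < q)%N -> phi2 (u1 k) = syz k.*2.+1.
Proof. by move=> lt_k; rewrite lincomb_evec // ltn_Sdouble. Qed.

Lemma phi2_kpre k : (k < q)%N -> phi2 (kpre k) = koszul k.
Proof.
move=> lt_k; rewrite linearB !linearZ /= phi2_u0 // phi2_u1 // /syz /= !odd_double /=.
rewrite uphalf_double doubleK /koszul; apply/rowP => j; rewrite !mxE /Fc /Fv.
have ET T : T ^+ b k = T ^+ (b k - c k) * T ^+ c k :> R by rewrite -exprD subnK ?bc.
rewrite !ET; ring.
Qed.

Lemma phi2_dpre k : (k < q)%N ->
  phi2 (dpre k) = Fc k *: e (kappa k) - Fd k *: e (mu k).
Proof.
move=> lt_k; rewrite linearB !linearZ /= phi2_u0 // phi2_u1 // /syz /= !odd_double /=.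
rewrite uphalf_double doubleK; apply/rowP => j; rewrite !mxE /Fc /Fd; ring.
Qed.

Lemma phi2_ssyz k : (k < q.-1)%N -> phi2 (ssyz k) = 0.
Proof.
move=> lt_k; have [lt_k' lt_k1] : (k < q)%N /\ (k.+1 < q)%N by lia.
have -> : ssyz k = kpre k.+1 - (-1) ^+ swap k *: dpre k by [].
rewrite linearB linearZ /= phi2_kpre // phi2_dpre // /koszul /kappa.
have := step lt_k'; case: (swap k) => -[-> -> ->].
  by rewrite expr1 scaleN1r opprK addrA subrK subrr.
by rewrite expr0 scale1r subrr.
Qed.

Lemma phi23 z : phi2 (phi3 z) = 0.
Proof. by apply: lincomb_comp => j; apply: phi2_ssyz. Qed.

(** The positions of the generators present before step [k]: all [Fv i] with [i <= k], together with
    [Fc k]. Earlier [Fc] have either persisted or become some [Fv]. *)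
Definition stage k i := (i <= k)%N || (i == mu k).
Definition supp_in (n : nat) (p : pred nat) (v : 'rV[R]_n) :=
  forall i, ~~ p i -> entry v i = 0.

Lemma kappa_stage k : (k < q)%N -> ~~ stage k (kappa k).
Proof.
move=> lt_k; rewrite /stage /kappa; have := step lt_k.
have := mu_bound mu_q mu_gt lt_k; have := mu_gt lt_k.
by case: ifP => _ ? ? [] *; lia.
Qed.

Lemma stageS k i : (k < q)%N -> stage k.+1 i = stage k i || (i == kappa k).
Proof.
move=> lt_k; rewrite /stage /kappa; have := step lt_k.
have := mu_bound mu_q mu_gt lt_k; have := mu_gt lt_k.
by case: ifP => _ ? ? [] *; lia.
Qed.

Lemma stage_mono k l i : (k <= l <= q)%N -> stage k i -> stage l i.
Proof.
case/andP=> le_kl; rewrite -(subnKC le_kl); elim: (l - k)%N => [|n IH].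
  by rewrite addn0.
by rewrite addnS => lt_n Hi; rewrite stageS // IH // ltnW.
Qed.

Lemma syz_supp k j : (k <= q)%N -> (j < k.*2)%N -> supp_in (stage k) (syz j).
Proof.
move=> le_k lt_j; have lt_jk : (j./2 < k)%N by rewrite ltn_half_double.
have lt_jq := leq_trans lt_jk le_k.
have [/andP [k_mu mu_q'] /andP [_ ka_q]] :=
  (mu_bound mu_q mu_gt (ltnW lt_jq), kappa_bound swap mu_q mu_gt lt_jq).
move=> i Hi; have out l : (l < q.+2)%N -> stage j./2.+1 l -> entry (e l) i = 0.
  move=> lt_l Hl; rewrite entry_evec //; case: eqP => // E; move: Hi; rewrite -E.
  by rewrite (stage_mono _ Hl) // lt_jk.
have s1 : stage j./2.+1 j./2 by rewrite stageS // /stage leqnn.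
have s2 : stage j./2.+1 (mu j./2) by rewrite stageS // /stage eqxx orbT.
have s3 : stage j./2.+1 (kappa j./2) by rewrite stageS // eqxx orbT.
by rewrite /syz; case: ifP => _; rewrite !entryB !entryZ !out ?mulr0 ?subrr //;
  rewrite ltnW // ltnW // ltnW.
Qed.

Lemma entry_e_other i j : (i < q.+2)%N -> i != j -> entry (e i) j = 0.
Proof. by move=> lt_i /negPf ij; rewrite entry_evec // ij. Qed.

Lemma entry_e_self i : (i < q.+2)%N -> entry (e i) i = 1.
Proof. by move=> lt_i; rewrite entry_evec // eqxx. Qed.

Lemma stage0_split (v : V1) : supp_in (stage 0) v ->
  v = entry v 0 *: e 0 + entry v (mu 0) *: e (mu 0).
Proof.
move=> Hv; have /andP [mu0 lt_mu] := mu_bound mu_q mu_gt (leq0n q).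
apply: entryP => i; rewrite entryD !entryZ !entry_evec //.
case: (eqVneq 0%N i) => [<-|i0]; first by rewrite gtn_eqF // mulr1 mulr0 addr0.
case: (eqVneq (mu 0) i) => [<-|im]; first by rewrite mulr1 mulr0 add0r.
by rewrite !mulr0 addr0 Hv // /stage leqn0 negb_or eq_sym i0 eq_sym im.
Qed.

Lemma drop_kappa k (v : V1) : (k < q)%N -> supp_in (stage k.+1) v ->
  entry v (kappa k) = 0 -> supp_in (stage k) v.
Proof.
move=> lt_k Hv v0 i Hi; case: (eqVneq i (kappa k)) => [->//|ik].
by apply: Hv; rewrite stageS // negb_or Hi.
Qed.

Lemma supp_sub_kappa k (v : V1) : (k < q)%N -> supp_in (stage k.+1) v ->
  supp_in (stage k) (v - entry v (kappa k) *: e (kappa k)).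
Proof.
move=> lt_k Hv; have /andP [_ lt_ka] := kappa_bound swap mu_q mu_gt lt_k.
apply: drop_kappa => // [i Hi|]; rewrite entryB entryZ.
  rewrite Hv // entry_e_other ?mulr0 ?subrr //.
  by apply: contraNneq Hi => <-; rewrite stageS // eqxx orbT.
by rewrite entry_e_self // mulr1 subrr.
Qed.

Lemma D_Fv k : (k < q)%N ->
  D k * Fv k = T0 ^+ c k * Fd k + T1 ^+ (b k - c k) * B k * Fc k.
Proof.
move=> lt_k; rewrite /Fv /Fc /Fd.
have ET T : T ^+ b k = T ^+ (b k - c k) * T ^+ c k :> R by rewrite -exprD subnK ?bc.
rewrite !ET; ring.
Qed.

(* After inverting the [x_j] every stage ideal is generated by the current    *)
(* pair of binomials.                                                         *)
Lemma stage_local k (v : V1) : (k <= q)%N -> supp_in (stage k) v ->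
  exists m x y, saturating m /\ m * phi1 v = x * Fv k + y * Fc k.
Proof.
elim: k v => [|k IH] v le_k Hv.
  have /andP [_ lt_mu] := mu_bound mu_q mu_gt (leq0n q).
  exists 1, (entry v 0), (entry v (mu 0)); split.
    by move=> j f a a'; rewrite mul1r => ->; exists a, a'.
  rewrite {1}(stage0_split Hv) linearD !linearZ /= !phi1_e // gen_Fv // gen_mu_Fc //.
  by rewrite mul1r.
have /andP [_ lt_ka] := kappa_bound swap mu_q mu_gt le_k.
have [m [x [y [Pm Em]]]] := IH _ (ltnW le_k) (supp_sub_kappa le_k Hv).
move: Em; rewrite linearB linearZ /= phi1_e // gen_kappa_Fd //.
set s := entry v _; rewrite -[_ *: _]/(s * Fd k) => Em.
have E : D k * m * phi1 v = (x * T0 ^+ c k + D k * m * s) * Fd k +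
    (x * (T1 ^+ (b k - c k) * B k) + D k * y) * Fc k.
  have -> : D k * m * phi1 v = D k * (m * (phi1 v - s * Fd k)) + D k * m * s * Fd k by ring.
  rewrite Em; have -> : D k * (x * Fv k + y * Fc k) = x * (D k * Fv k) + D k * y * Fc k by ring.
  rewrite D_Fv //; ring.
have := step le_k; case: ifP => _.
  by case=> -> -> _; exists (D k * m); do 2!eexists;
    split; [exact: saturatingM (@saturating_D k) Pm | rewrite E addrC].
by case=> -> -> _; exists (D k * m); do 2!eexists;
  split; [exact: saturatingM (@saturating_D k) Pm | rewrite E].
Qed.

Lemma stage_colon k m s x y : (k < q)%N -> saturating m ->
  m * (s * Fd k) = x * Fv k + y * Fc k ->
  exists a a', s = a * T0 ^+ c k + a' * T1 ^+ c k.
Proof.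
move=> lt_k Pm E.
have /(Fd_regular lt_k) [h Eh] : (D k * m * s - x * T0 ^+ c k) * Fd k =
    (x * (T1 ^+ (b k - c k) * B k) + D k * y) * Fc k.
  have -> : (D k * m * s - x * T0 ^+ c k) * Fd k =
      D k * (m * (s * Fd k)) - x * T0 ^+ c k * Fd k by ring.
  rewrite E; have -> : D k * (x * Fv k + y * Fc k) = x * (D k * Fv k) + D k * y * Fc k by ring.
  rewrite D_Fv //; ring.
apply: (@saturatingM _ _ (@saturating_D k) Pm (c k) s (x + h * C k) (- h * D k)).
have -> : D k * m * s = D k * m * s - x * T0 ^+ c k + x * T0 ^+ c k by rewrite subrK.
rewrite Eh /Fc; ring.
Qed.

(** Induction on stages: the coefficient of the newest generator lies in the colon ideal (T0^c,
    T1^c), hence is removed by the two syzygies of the step. At stage 0 regularity leaves only the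
    Koszul relation. *)
Lemma stage_exact k (v : V1) : (k <= q)%N -> supp_in (stage k) v -> phi1 v = 0 ->
  exists r w, v = r *: koszul 0 + phi2 w.
Proof.
elim: k v => [|k IH] v le_k Hv v0.
  have /andP [_ lt_mu] := mu_bound mu_q mu_gt (leq0n q).
  have E0 : entry v 0 * Fv 0 + entry v (mu 0) * Fc 0 = 0.
    rewrite -[RHS]v0 {3}(stage0_split Hv) linearD !linearZ /= !phi1_e //.
    by rewrite gen_Fv // gen_mu_Fc.
  have /Fv0_regular [h Eh] : entry v 0 * Fv 0 = - entry v (mu 0) * Fc 0.
    by apply/eqP; rewrite mulNr -addr_eq0 E0.
  have Em : entry v (mu 0) = - (h * Fv 0).
    apply: (mulIf Fc0_neq0); apply/eqP; rewrite mulNr mulrAC -Eh.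
    by rewrite -addr_eq0 addrC E0.
  exists h, 0; rewrite linear0 addr0 {1}(stage0_split Hv) Eh Em /koszul.
  by rewrite scalerBr !scalerA scaleNr.
have /andP [_ lt_ka] := kappa_bound swap mu_q mu_gt le_k.
have /andP [k_mu mu_q'] := mu_bound mu_q mu_gt (ltnW le_k).
have lt_k2 : (k < q.+2)%N by rewrite ltnW // ltnW // ltnW.
have Hv' := supp_sub_kappa le_k Hv.
have [m [x [y [Pm Em]]]] := stage_local (ltnW le_k) Hv'.
move: Em; rewrite linearB linearZ /= v0 phi1_e // gen_kappa_Fd // sub0r mulrN => Em.
have {Em} : m * (entry v (kappa k) * Fd k) = - x * Fv k + - y * Fc k.
  by rewrite -[LHS]opprK Em opprD !mulNr.
case/(stage_colon le_k Pm) => a [a' Es].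
(* At [kappa k] the two syzygies have entries [- T1 ^+ c k] and [- T0 ^+ c k], so adding [phi2 w]
   clears that coordinate of [v]. *)
pose w := a' *: u0 k + a *: u1 k.
have Ew : phi2 w = a' *: syz k.*2 + a *: syz k.*2.+1.
  by rewrite linearD !linearZ /= phi2_u0 ?phi2_u1.
have [||r [w' E]] := IH (v + phi2 w) (ltnW le_k); last 1 first.
- by exists r, (w' - w); rewrite [lincomb _ (w' - w)]linearB addrA -E addrK.
- apply: drop_kappa => // [i Hi|].
    by rewrite entryD Ew Hv // entryD !entryZ !(@syz_supp k.+1) ?mulr0 ?addr0 //;
      rewrite ?doubleS.
  rewrite entryD Ew entryD !entryZ /syz /= !odd_double /= uphalf_double doubleK.
  rewrite !entryB !entryZ entry_e_self // !entry_e_other //.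
  + by rewrite Es; ring.
  + by apply: contraNneq (kappa_stage le_k) => <-; rewrite /stage eqxx orbT.
  + by apply: contraNneq (kappa_stage le_k) => <-; rewrite /stage leqnn.
- by rewrite linearD /= v0 phi12 addr0.
Qed.

Lemma stage_q i : (i < q.+2)%N -> stage q i.
Proof. by rewrite /stage mu_q ltnS leq_eqVlt orbC. Qed.

Lemma phi1_exact (v : V1) : phi1 v = 0 -> exists w, phi2 w = v.
Proof.
move=> v0; have [|r [w ->]] := @stage_exact q v (leqnn q) _ v0.
  by move=> i Hi; apply: entry_ge; rewrite leqNgt; apply: contra Hi; apply: stage_q.
by exists (r *: kpre 0 + w); rewrite linearD linearZ /= phi2_kpre.
Qed.

Definition below m i := (i < m)%N.

Lemma below_split m k (w : 'rV[R]_m) : (k < m)%N -> supp_in (below k.+1) w ->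
  exists2 w' : 'rV[R]_m, supp_in (below k) w' & w = w' + entry w k *: evec R m k.
Proof.
move=> lt_k Hw; exists (w - entry w k *: evec R m k); last by rewrite subrK.
move=> i Hi; rewrite entryB entryZ entry_evec //.
case: eqP => [<-|/eqP ki]; first by rewrite mulr1 subrr.
by rewrite mulr0 subr0 Hw // /below; move: Hi; rewrite /below; lia.
Qed.

Lemma phi2_supp k (w : V2) : (k <= q)%N -> supp_in (below k.*2) w ->
  supp_in (stage k) (phi2 w).
Proof.
move=> le_k Hw i Hi; rewrite entry_lincomb big1 // => j _.
case: (ltnP j k.*2) => [lt_j|le_j]; first by rewrite (syz_supp le_k lt_j) ?mulr0.
by rewrite Hw ?mul0r // /below -leqNgt.
Qed.

Lemma below_ge k i : (k <= i)%N -> ~~ below k i.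
Proof. by rewrite /below -leqNgt. Qed.

(** The second level of the cone: the top two coefficients of a second syzygy form a multiple of the
    Koszul syzygy of (T0^c, T1^c), and [ssyz] removes it. *)
Lemma phi2_exact_below k (w : V2) : (k <= q)%N -> supp_in (below k.*2) w ->
  phi2 w = 0 -> exists z, phi3 z = w.
Proof.
elim: k w => [|k IH] w le_k Hw w0.
  exists 0; rewrite linear0; apply: entryP => i.
  by rewrite entry0 Hw.
have /andP [_ lt_ka] := kappa_bound swap mu_q mu_gt le_k.
have lt_u0 : (k.*2 < q.*2)%N by rewrite ltn_double.
have lt_u1 : (k.*2.+1 < q.*2)%N by rewrite ltn_Sdouble.
have /andP [k_mu mu_q'] := mu_bound mu_q mu_gt (ltnW le_k).
have lt_k2 : (k < q.+2)%N by rewrite ltnW // ltnW // ltnW.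
have [w1 Hw1 Ew1] := below_split lt_u1 Hw.
have [w2 Hw2 Ew2] := below_split lt_u0 Hw1.
set y := entry w _ in Ew1; set x := entry w1 _ in Ew2.
(* Of the syzygies involved, only the two of step [k] have a nonzero entry at [kappa k]. *)
have [h [Ey Ex]] : exists h, y = h * T1 ^+ c k /\ x = - (h * T0 ^+ c k).
  apply: regular; have := congr1 (fun v => entry v (kappa k)) w0.
  rewrite Ew1 Ew2 !linearD !linearZ /= phi2_u0 ?phi2_u1 // !entryD !entryZ entry0.
  rewrite (phi2_supp (ltnW le_k) Hw2) ?kappa_stage // add0r.
  rewrite /syz /= !odd_double /= uphalf_double doubleK !entryB !entryZ.
  rewrite entry_e_self // !entry_e_other //.
  + by rewrite !mulr0 !subr0 !sub0r !mulr1 !mulrN => /eqP; rewrite -opprD oppr_eq0 addrC => /eqP.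
  + by apply: contraNneq (kappa_stage le_k) => <-; rewrite /stage eqxx orbT.
  + by apply: contraNneq (kappa_stage le_k) => <-; rewrite /stage leqnn.
have Ew : w = w2 - h *: kpre k.
  rewrite Ew1 Ew2 Ex Ey /kpre scalerBr !scalerA opprB addrA addrAC scaleNr.
  by rewrite -addrA [- _ + _]addrC addrA.
clearbody x y; clear Hw Hw1 Ew1 Ew2 Ey Ex w1 lt_ka k_mu mu_q' lt_k2.
(* At step 0 nothing is left but a multiple of [kpre 0], and its image, a multiple of [koszul 0],
   vanishes only for [h = 0]. *)
case: k => [|k] in IH le_k lt_u0 lt_u1 Hw2 Ew w0 *.
  have w20 : w2 = 0 by apply: entryP => i; rewrite entry0 Hw2.
  move: w0; rewrite Ew w20 sub0r linearN linearZ /= phi2_kpre // => /eqP.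
  rewrite oppr_eq0 => /eqP/(congr1 (fun v => entry v 0)).
  have /andP [mu0 lt_mu] := mu_bound mu_q mu_gt (leq0n q).
  rewrite entryZ entryB !entryZ entry_e_self // entry_e_other ?gtn_eqF // entry0.
  rewrite mulr1 mulr0 subr0 => /eqP; rewrite mulf_eq0 (negPf Fc0_neq0) orbF => /eqP ->.
  by exists 0; rewrite linear0 scale0r oppr0.
have lt_k1 : (k < q.-1)%N by lia.
(* Adding [h *: ssyz k] trades [kpre k.+1] for a multiple of [dpre k], which is supported on the
   steps up to [k]. *)
have [||z Ez] := IH (w + h *: ssyz k) (ltnW le_k).
- have -> : w + h *: ssyz k = w2 - h *: ((-1) ^+ swap k *: dpre k).
    rewrite Ew -[ssyz k]/(kpre k.+1 - (-1) ^+ swap k *: dpre k).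
    by rewrite [h *: (kpre _ - _)]scalerBr addrA subrK.
  have [lt0 lt1] : (k.*2 < q.*2)%N /\ (k.*2.+1 < q.*2)%N.
    by rewrite ltn_double ltn_Sdouble ltnW.
  move=> i Hi; rewrite entryB !entryZ Hw2 // entryB !entryZ !entry_evec //.
  move: Hi; rewrite /below doubleS -leqNgt => Hi.
  by rewrite !ltn_eqF ?(leq_trans _ Hi) // !mulr0 subrr !mulr0 subr0.
- by rewrite linearD linearZ /= w0 phi2_ssyz // scaler0 addr0.
exists (z - h *: evec R q.-1 k).
by rewrite linearB linearZ /= Ez lincomb_evec // addrK.
Qed.

Lemma supp_below_full m (w : 'rV[R]_m) : supp_in (below m) w.
Proof. by move=> i; rewrite /below -leqNgt; apply: entry_ge. Qed.

Lemma phi2_exact (w : V2) : phi2 w = 0 -> exists z, phi3 z = w.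
Proof. by apply: (phi2_exact_below (leqnn q)); apply: supp_below_full. Qed.

(** Position [l.+1.*2] is the leading coordinate of [ssyz l]; with nonzero diagonal entries T0^c,
    [phi3] is triangular and therefore injective. *)
Lemma entry_ssyz_top k l : (k <= l)%N -> (l < q.-1)%N ->
  entry (ssyz k) l.+1.*2 = T0 ^+ c k.+1 * (k == l)%:R.
Proof.
move=> le_kl lt_l; have [h1 h2] : (k < q)%N /\ (k.+1 < q)%N by lia.
rewrite /ssyz !entryB !entryZ !entryB !entryZ !entry_evec ?ltn_double ?ltn_Sdouble //.
have -> : (k.+1.*2 == l.+1.*2) = (k == l) by apply/eqP/eqP; lia.
have -> : (k.+1.*2.+1 == l.+1.*2) = false by apply/eqP; lia.
have -> : (k.*2 == l.+1.*2) = false by apply/eqP; lia.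
have -> : (k.*2.+1 == l.+1.*2) = false by apply/eqP; lia.
by rewrite !mulr0 !subr0 mulr0 subr0.
Qed.

Lemma phi3_inj_below k (z : V3) : (k <= q.-1)%N -> supp_in (below k) z ->
  phi3 z = 0 -> z = 0.
Proof.
elim: k z => [|k IH] z le_k Hz z0; first by apply: entryP => i; rewrite entry0 Hz.
suff zk : entry z k = 0.
  apply: IH z0; first exact: ltnW.
  move=> i Hi; case: (eqVneq i k) => [->//|ik]; apply: Hz.
  by move: Hi; rewrite /below; lia.
have := congr1 (fun v => entry v k.+1.*2) z0; rewrite entry0 entry_lincomb.
rewrite (bigD1 (Ordinal le_k)) //= big1 ?addr0 => [|j jk].
  rewrite entry_ssyz_top // eqxx mulr1 => /eqP.
  by rewrite mulf_eq0 expf_eq0 (negPf T0_neq0) andbF orbF => /eqP.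
have {}jk : j != k :> nat by [].
case: (ltnP j k.+1) => [lt_j|le_j]; last by rewrite Hz ?mul0r ?below_ge.
by rewrite entry_ssyz_top // (negPf jk) !mulr0.
Qed.

Lemma phi3_inj : injective phi3.
Proof.
move=> x y E; apply/eqP; rewrite -subr_eq0; apply/eqP.
apply: (phi3_inj_below (leqnn _)); first exact: supp_below_full.
by rewrite linearB /= E subrr.
Qed.

End Tower.

(** * The map Phi0 *)

Lemma big_ord2 (R : Type) idx (op : Monoid.law (idx : R)) (F : 'I_2 -> R) :
  \big[op/idx]_(i < 2) F i = op (F 0) (F 1).
Proof.
rewrite !big_ord_recl big_ord0 Monoid.mulm1.
by congr (op (F _) (F _)); apply: val_inj.
Qed.

Lemma big_ord3 (R : Type) idx (op : Monoid.law (idx : R)) (F : 'I_3 -> R) :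
  \big[op/idx]_(i < 3) F i = op (F 0) (op (F 1) (F 2)).
Proof.
rewrite !big_ord_recl big_ord0 Monoid.mulm1.
by congr (op (F _) (op (F _) (F _))); apply: val_inj.
Qed.

Section Phi0.
Variables (K : fieldType) (d u : nat).
Local Notation S := (ringS K).
Local Notation Phi := (Phi0 (K := K) d u).
Implicit Types (f g : S) (m : 'X_{1..2 + 3}).

Lemma Phi0M f g : Phi (f * g) = Phi f * Phi g.
Proof. exact: (rmorphM (mmap (polyC \o @mpolyC 2 K) _)). Qed.

Lemma Phi0D f g : Phi (f + g) = Phi f + Phi g.
Proof. exact: (rmorphD (mmap (polyC \o @mpolyC 2 K) _)). Qed.

Lemma Phi0B f g : Phi (f - g) = Phi f - Phi g.
Proof. exact: (rmorphB (mmap (polyC \o @mpolyC 2 K) _)). Qed.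

Lemma Phi0_0 : Phi 0 = 0.
Proof. exact: (rmorph0 (mmap (polyC \o @mpolyC 2 K) _)). Qed.

Lemma Phi0_sum (I : Type) (r : seq I) (P : pred I) (F : I -> S) :
  Phi (\sum_(i <- r | P i) F i) = \sum_(i <- r | P i) Phi (F i).
Proof. exact: (rmorph_sum (mmap (polyC \o @mpolyC 2 K) _)). Qed.

Lemma Phi0Xn f n : Phi (f ^+ n) = Phi f ^+ n.
Proof. exact: (rmorphXn (mmap (polyC \o @mpolyC 2 K) _)). Qed.

Lemma Phi0C c : Phi c%:MP = (c%:MP)%:P.
Proof. exact: (mmapC _ (polyC \o @mpolyC 2 K)). Qed.

Lemma Phi0_tv i : Phi (tv K i) = ('X_i)%:P.
Proof.
rewrite /Phi0 /tv (mmapX _ (polyC \o @mpolyC 2 K)) mmap1U.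
by rewrite -[lshift 3 i]/(unsplit (inl i)) unsplitK.
Qed.

Lemma Phi0_xv j : Phi (xv K j) = (gens K d u j)%:P * 'X.
Proof.
rewrite /Phi0 /xv (mmapX _ (polyC \o @mpolyC 2 K)) mmap1U.
by rewrite -[rshift 2 j]/(unsplit (inr j)) unsplitK.
Qed.

Definition tmon (a b : nat) : 'X_{1..2} := (U_(0%R) *+ a + U_(1%R) *+ b)%MM.

Lemma tmonE a b : 'X_[tmon a b] = T0 K ^+ a * T1 K ^+ b.
Proof. by rewrite /tmon mpolyXD -!mpolyXn. Qed.

Lemma tmon_inj a b a' b' : (tmon a b == tmon a' b') = (a == a') && (b == b').
Proof.
apply/eqP/andP => [E|[/eqP-> /eqP->] //].
have H (i : 'I_2) := congr1 (fun m : 'X_{1..2} => m i) E.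
have := (H 0, H 1); rewrite /tmon !mnmDE !mulmnE !mnmE /=.
by rewrite !(muln0, mul0n, addn0, add0n, muln1, mul1n) => -[-> ->].
Qed.

Definition mt m i := m (lshift 3 i).
Definition mx m j := m (rshift 2 j).
Definition tdeg0 m := (mt m 0%R + d * mx m 0%R + (d - u) * mx m 1%R)%N.
Definition tdeg1 m := (mt m 1%R + u * mx m 1%R + d * mx m 2%R)%N.

Lemma XdegE m : Xdeg m = (mx m 0%R + mx m 1%R + mx m 2%R)%N.
Proof. by rewrite /Xdeg big_ord3 /= addnA. Qed.

Lemma TdegE m : Tdeg m = (mt m 0%R + mt m 1%R)%N.
Proof. by rewrite /Tdeg big_ord2. Qed.

Lemma mpolyX5 m : 'X_[m] = tv K 0 ^+ mt m 0%R * tv K 1 ^+ mt m 1%R *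
  (xv K 0 ^+ mx m 0%R * (xv K 1 ^+ mx m 1%R * xv K 2 ^+ mx m 2%R)) :> S.
Proof.
have E : 'X_[m] = \prod_(i < 2 + 3) 'X_i ^+ m i :> S by exact: mpolyXE_id.
by rewrite E big_split_ord /= big_ord2 big_ord3.
Qed.

Lemma Phi0X m : Phi 'X_[m] = ('X_[tmon (tdeg0 m) (tdeg1 m)])%:P * 'X^(Xdeg m).
Proof.
have H (R : comNzRingType) (a b z : R) (e f i j k l n : nat) :
  a ^+ i * b ^+ j * ((a ^+ d * z) ^+ k * ((a ^+ e * b ^+ f * z) ^+ l * (b ^+ d * z) ^+ n)) =
  a ^+ (i + d * k + e * l) * b ^+ (j + f * l + d * n) * z ^+ (k + l + n).
  by rewrite !exprMn !exprD !exprM; ring.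
have CX (p : ringR K) n : (p ^+ n)%:P = p%:P ^+ n by exact: polyC_exp.
rewrite mpolyX5 !Phi0M !Phi0Xn !Phi0_tv !Phi0_xv /gens !(tnth_nth 0) /=.
rewrite [(T0 K ^+ (d - u) * _)%:P]polyCM !CX.
by rewrite H -XdegE tmonE polyCM !CX.
Qed.

Definition same_image m m' :=
  [&& tdeg0 m == tdeg0 m', tdeg1 m == tdeg1 m' & Xdeg m == Xdeg m'].

Lemma Phi0_expand f : Phi f = \sum_(m <- msupp f)
  (f@_m *: 'X_[tmon (tdeg0 m) (tdeg1 m)])%:P * 'X^(Xdeg m).
Proof.
rewrite {1}[f]mpolyE Phi0_sum; apply: eq_bigr => m _.
by rewrite -mul_mpolyC Phi0M Phi0C Phi0X mulrA -polyCM mul_mpolyC.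
Qed.

Lemma coef_Phi0 f n : (Phi f)`_n = \sum_(m <- msupp f | n == Xdeg m)
  f@_m *: 'X_[tmon (tdeg0 m) (tdeg1 m)].
Proof.
rewrite Phi0_expand coef_sum [RHS]big_mkcond; apply: eq_bigr => m _.
by rewrite coefCM coefXn; case: eqP; rewrite ?mulr1 ?mulr0.
Qed.

Lemma mcoeff_Phi0 f n a b : ((Phi f)`_n)@_(tmon a b) =
  \sum_(m <- msupp f | [&& tdeg0 m == a, tdeg1 m == b & Xdeg m == n]) f@_m.
Proof.
rewrite coef_Phi0 raddf_sum /= big_mkcond [RHS]big_mkcond; apply: eq_bigr => m _.
rewrite mcoeffZ mcoeffX tmon_inj [n == _]eq_sym.
by case: (Xdeg m == n); rewrite ?andbT ?andbF //; case: (_ && _); rewrite ?mulr1 ?mulr0.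
Qed.

Lemma Phi0_bihomogeneous : (u <= d)%N ->
  bihomogeneous (@S_comp K) (@RZ_comp K d) (@Phi0 K d u).
Proof.
move=> le_ud k l f Hf n m; rewrite coef_Phi0.
move/msupp_sum_le; case/flatten_mapP => m'; rewrite mem_filter => /andP [/eqP -> Hm'].
move/msuppZ_le; rewrite msuppX inE => /eqP ->; have [<- <-] := Hf _ Hm'; split=> //.
rewrite /tmon mdegD !mdegMn !mdeg1 TdegE XdegE /tdeg0 /tdeg1; nia.
Qed.

(* In each fibre of [m |-> Phi0 X^m] the coefficients sum to 0.               *)
Lemma Phi0_kernel_binomials (J : S -> Prop) :
  J 0 -> (forall f g, J f -> J g -> J (f + g)) -> (forall f g, J g -> J (f * g)) ->
  (forall m m', same_image m m' -> J ('X_[m] - 'X_[m'])) ->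
  forall f, Phi f = 0 -> J f.
Proof.
move=> J0 JD JM JX f; have [n] := ubnP (size (msupp f)).
elim: n f => // n IH f lt_n f0.
case: (eqVneq f 0) => [->//|]; rewrite -msupp_eq0.
case E: (msupp f) => [//|m s] _; have Hm : m \in msupp f by rewrite E mem_head.
have [m' /and3P [m'm Hm' Emm']] : exists m', [&& m' != m, m' \in msupp f & same_image m' m].
  have := mcoeff_Phi0 f (Xdeg m) (tdeg0 m) (tdeg1 m).
  rewrite f0 coef0 mcoeff0 big_mkcond (bigD1_seq m) ?msupp_uniq //= !eqxx /=.
  move=> /esym Es; case: (boolP (has (fun m' => (m' != m) && same_image m' m) (msupp f))).
    by case/hasP => m' H1 /andP [H2 H3]; exists m'; rewrite H1 H2.
  rewrite -all_predC => /allP Hall; move: Es; rewrite big_seq_cond big1 ?addr0.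
    by move=> Ef; move: Hm; rewrite mcoeff_msupp Ef eqxx.
  move=> m' /andP [/Hall /=]; rewrite negb_and negbK => H m'm.
  by case: ifP => // Em; move: H; rewrite /same_image Em (negPf m'm).
(* Moving the coefficient of [m] to [m'], in the same fibre and already in the support, removes [m]
   and adds no new monomial. *)
pose f1 := f - (f@_m)%:MP * ('X_[m] - 'X_[m']).
have -> : f = f1 + (f@_m)%:MP * ('X_[m] - 'X_[m']) by rewrite subrK.
apply: JD; last by apply/JM/JX; case/and3P: Emm' => *; apply/and3P; split; rewrite eq_sym.
apply: IH; last first.
  rewrite /f1 Phi0B f0 Phi0M Phi0B !Phi0X.
  by case/and3P: Emm' => /eqP -> /eqP -> /eqP ->; rewrite subrr mulr0 subr0.
rewrite -ltnS; apply: leq_trans lt_n; rewrite !ltnS.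
have f1m : f1@_m = 0.
  rewrite mcoeffB mcoeffCM mcoeffB !mcoeffX eqxx (negPf m'm) subr0 mulr1 subrr //.
apply: (@leq_ltn_trans (size (rem m (msupp f)))); last first.
  by rewrite E /= eqxx.
apply: uniq_leq_size (msupp_uniq _) _ => x Hx.
rewrite (mem_rem_uniq _ (msupp_uniq _)) inE.
have xm : x != m by apply: contraTneq Hx => ->; rewrite mcoeff_msupp f1m eqxx.
rewrite xm /=; apply: contraTT Hx; rewrite !mcoeff_msupp !negbK => /eqP fx.
rewrite mcoeffB mcoeffCM mcoeffB !mcoeffX fx [m == x]eq_sym (negPf xm).
case: (eqVneq m' x) => [E'|_]; last by rewrite /= subr0 mulr0 subr0.
by move: Hm'; rewrite E' mcoeff_msupp fx eqxx.
Qed.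

End Phi0.

(** * The Rees algebra is the image of Phi0 *)

Section IdealPowers.
Variables (A : comNzRingType) (k : nat) (g : 'I_k -> A).
Local Notation I := (ideal_gen g).

Lemma ideal_gen_mem j : I (g j).
Proof.
exists (fun i => (i == j)%:R); rewrite (bigD1 j) //= eqxx mul1r big1 ?addr0 //.
by move=> i /negPf ->; rewrite mul0r.
Qed.

Lemma ideal_genM r x : I x -> I (r * x).
Proof.
case=> c ->; exists (fun i => r * c i); rewrite mulr_sumr.
by apply: eq_bigr => i _; rewrite mulrA.
Qed.

Lemma ideal_mul_mem (J L : A -> Prop) x y : J x -> L y -> ideal_mul J L (x * y).
Proof. by move=> Jx Ly; exists 1%N, (fun=> x), (fun=> y); rewrite big_ord1. Qed.

Lemma ideal_mul0 (J L : A -> Prop) : ideal_mul J L 0.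
Proof. by exists 0%N, (fun=> 0), (fun=> 0); split; rewrite ?big_ord0 // => -[]. Qed.

Lemma ideal_mulD (J L : A -> Prop) x y :
  ideal_mul J L x -> ideal_mul J L y -> ideal_mul J L (x + y).
Proof.
case=> [m [f [h [Jf Lh ->]]]] [m' [f' [h' [Jf' Lh' ->]]]].
pose F i := match split i with inl i => f i | inr i => f' i end.
pose H i := match split i with inl i => h i | inr i => h' i end.
exists (m + m')%N, F, H; split=> [i|i|].
- by rewrite /F; case: (split i).
- by rewrite /H; case: (split i).
rewrite big_split_ord /=; congr (_ + _); apply: eq_bigr => i _; rewrite /F /H.
  by rewrite -[lshift m' i]/(unsplit (inl i)) unsplitK.
by rewrite -[rshift m i]/(unsplit (inr i)) unsplitK.
Qed.

Lemma ideal_pow0 n : ideal_pow I n 0.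
Proof. by case: n => //= n; apply: ideal_mul0. Qed.

Lemma ideal_powD n x y : ideal_pow I n x -> ideal_pow I n y -> ideal_pow I n (x + y).
Proof. by case: n => //= n; apply: ideal_mulD. Qed.

Lemma ideal_powM n r x : ideal_pow I n x -> ideal_pow I n (r * x).
Proof.
case: n => //= n [m [f [h [If Lh ->]]]]; exists m, (fun i => r * f i), h.
split=> // [i|]; first exact: ideal_genM.
by rewrite mulr_sumr; apply: eq_bigr => i _; rewrite mulrA.
Qed.

Lemma ideal_pow_genX j l n x : ideal_pow I n x -> ideal_pow I (l + n) (g j ^+ l * x).
Proof.
move=> Ix; elim: l => [|l IH]; first by rewrite mul1r.
by rewrite exprS -mulrA; apply: ideal_mul_mem; first exact: ideal_gen_mem.
Qed.

End IdealPowers.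

Section ReesImage.
Variables (K : fieldType) (d u : nat).
Local Notation S := (ringS K).
Local Notation Phi := (Phi0 (K := K) d u).
Local Notation g := (gens K d u).

Lemma tmon_ideal_pow (m : 'X_{1..2 + 3}) :
  ideal_pow (idealI (K := K) d u) (Xdeg m) 'X_[tmon (tdeg0 d u m) (tdeg1 d u m)].
Proof.
pose r := T0 K ^+ mt m 0%R * T1 K ^+ mt m 1%R.
have -> : 'X_[tmon (tdeg0 d u m) (tdeg1 d u m)] =
    g 0 ^+ mx m 0%R * (g 1 ^+ mx m 1%R * (g 2 ^+ mx m 2%R * r)).
  rewrite tmonE /gens !(tnth_nth 0) /= /r.
  move: (T0 K) (T1 K) => a b; have H (R : comNzRingType) (x y : R) i j k l n e :
      x ^+ (i + d * k + e * l) * y ^+ (j + u * l + d * n) =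
      (x ^+ d) ^+ k * ((x ^+ e * y ^+ u) ^+ l * ((y ^+ d) ^+ n * (x ^+ i * y ^+ j))).
    by rewrite !exprMn !exprD !exprM; ring.
  exact: H.
have -> : Xdeg m = (mx m 0%R + (mx m 1%R + (mx m 2%R + 0)))%N by rewrite XdegE addn0 addnA.
by do 3!apply: ideal_pow_genX.
Qed.

Lemma Rees_Phi0 f : Rees d u (Phi f).
Proof.
move=> n; rewrite coef_Phi0.
apply: (big_ind (ideal_pow (idealI (K := K) d u) n)).
- exact: ideal_pow0.
- exact: ideal_powD.
by move=> m /eqP ->; rewrite -mul_mpolyC; apply/ideal_powM/tmon_ideal_pow.
Qed.

Lemma Phi0_image_sum (I : Type) (r : seq I) (P : pred I) (F : I -> ringRZ K) :
  (forall i, P i -> exists s, Phi s = F i) -> exists s, Phi s = \sum_(i <- r | P i) F i.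
Proof.
move=> HF; apply: (big_ind (fun f => exists s, Phi s = f)) => // [|_ _ [s <-] [t <-]].
  by exists 0; rewrite Phi0_0.
by exists (s + t); rewrite Phi0D.
Qed.

Lemma mpolyX2 (m : 'X_{1..2}) : 'X_[m] = 'X_0 ^+ m 0%R * 'X_1 ^+ m 1%R :> ringR K.
Proof. by rewrite (@mpolyXE_id 2 K m) big_ord2. Qed.

Lemma Phi0_lift (h : ringR K) : exists s, Phi s = h%:P.
Proof.
rewrite [h]mpolyE rmorph_sum; apply: Phi0_image_sum => m _.
exists ((h@_m)%:MP * (tv K 0 ^+ m 0%R * tv K 1 ^+ m 1%R)).
rewrite !Phi0M !Phi0Xn Phi0C !Phi0_tv -mul_mpolyC (mpolyX2 m).
have CX (p : ringR K) n : (p ^+ n)%:P = p%:P ^+ n by exact: polyC_exp.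
by rewrite /= [RHS]polyCM [X in _ = _ * X]polyCM !CX.
Qed.

(** An element of I^(n+1) is a sum of terms c g_j h with h in I^n, and g_j Z is the image of X_j. *)
Lemma ideal_pow_image n h : ideal_pow (idealI (K := K) d u) n h ->
  exists s, Phi s = h%:P * 'X^n.
Proof.
elim: n h => [|n IH] h; first by move=> _; rewrite mulr1; apply: Phi0_lift.
case=> l [f [h' [If Ih ->]]]; rewrite rmorph_sum /= mulr_suml.
apply: Phi0_image_sum => i _; have [c ->] := If i; have [s Es] := IH _ (Ih i).
rewrite mulr_suml rmorph_sum /= mulr_suml; apply: Phi0_image_sum => j _.
have [t Et] := Phi0_lift (c j); exists (t * xv K j * s).
rewrite !Phi0M Et Es Phi0_xv !polyCM exprS; ring.
Qed.

Lemma Rees_image f : Rees d u f <-> exists s, Phi s = f.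
Proof.
split=> [Rf|[s <-]]; last exact: Rees_Phi0.
rewrite -[f]coefK poly_def; apply: Phi0_image_sum => i _.
by rewrite -mul_polyC; apply: ideal_pow_image.
Qed.

End ReesImage.

(** * The slow Euclidean sequence *)

(* Absolute values of the entries of [sers_state]: [sgn] is true when         *)
(* [sigma <= 0 <= tau] and [beta <= 0 <= alpha], and false when the opposite  *)
(* inequalities hold.                                                         *)
Record state := State {
  sb : nat; sc : nat; ssig : nat; stau : nat; salp : nat; sbet : nat; sgn : bool }.

Definition swaps x := (sb x - sc x < sc x)%N.

Definition slow_step x :=
  if swaps x then
    State (sc x) (sb x - sc x) (salp x) (sbet x)
      (ssig x + salp x) (stau x + sbet x) (~~ sgn x)
  else
    State (sb x - sc x) (sc x) (ssig x + salp x) (stau x + sbet x)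
      (salp x) (sbet x) (sgn x).

(** Indexed from 0: [slow d u k] encodes [sers d u k.+1] ([sers_slow]). *)
Definition slow d u k := iter k slow_step (State (d - u) u 0 1 1 0 true).

Definition sers_of x : sers_state :=
  let pm (e : bool) (n : nat) : int := if e then n%:Z else - n%:Z in
  SersState (sb x) (sc x) (pm (~~ sgn x) (ssig x)) (pm (sgn x) (stau x))
    (pm (sgn x) (salp x)) (pm (~~ sgn x) (sbet x)).

Lemma sers_of_slow_step x : (sc x <= sb x)%N -> sers_step (sers_of x) = sers_of (slow_step x).
Proof.
case: x => b c s t s' t' o /= le_cb; rewrite /slow_step /swaps /sers_step /sers_of /=.
rewrite subzn // lez_nat ltnNge.
by case: ifP => _ /=; case: o => /=; congr SersState; lia.
Qed.

Section Slow.
Variables (d u : nat).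
Hypotheses (u_gt0 : (0 < u)%N) (ud : (2 * u < d)%N).
Local Notation st := (slow d u).

Lemma slowS k : st k.+1 = slow_step (st k).
Proof. by []. Qed.

Lemma slow_le k : (sc (st k) <= sb (st k))%N.
Proof.
elim: k => [|k IH]; first by rewrite /=; lia.
rewrite slowS /slow_step; case: ifP; rewrite /swaps /=; lia.
Qed.

Lemma slow_pos k : (0 < ssig (st k) + stau (st k))%N && (0 < salp (st k) + sbet (st k))%N.
Proof.
elim: k => [//|k /andP [IH1 IH2]]; rewrite slowS /slow_step.
by case: ifP => _ /=; apply/andP; split=> //; rewrite addnACA addn_gt0 IH1.
Qed.

Lemma slow_coprime k : coprime u d -> coprime (sb (st k)) (sc (st k)).
Proof.
move=> co; elim: k => [|k IH].
  by rewrite /= /coprime gcdnC -gcdnDr subnK //; lia.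
have le := slow_le k; rewrite slowS /slow_step; case: ifP => _ /=.
  by rewrite /coprime -gcdnDr subnK // gcdnC.
by rewrite /coprime gcdnC -gcdnDr subnK // gcdnC.
Qed.

(* The vector [b gamma - c v] has degree [b c - c b = 0], hence it is         *)
(* proportional to [(d - u, - u)]; the factor is constant up to sign.         *)
Lemma slow_invariant k :
  (sb (st k) * salp (st k) + sc (st k) * ssig (st k) = d - u)%N /\
  (sb (st k) * sbet (st k) + sc (st k) * stau (st k) = u)%N.
Proof.
elim: k => [|k [IH1 IH2]]; first by rewrite /=; lia.
have := slow_le k; rewrite slowS /slow_step; move: (st k) IH1 IH2 => [b c s t s' t' o] /=.
move=> E1 E2 le_cb; have [e Eb] : exists e, b = (e + c)%N by exists (b - c)%N; rewrite subnK.
by case: (swaps _) => /=; rewrite -E1 -E2 Eb addnK; split; ring.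
Qed.

Lemma sers_slow k : sers d u k.+1 = sers_of (st k).
Proof.
rewrite /sers /=; elim: k => [|k IH]; last by rewrite iterS IH sers_of_slow_step // slow_le.
by rewrite /sers_of /= subzn //; lia.
Qed.

(* The values of the linear form [(sigma, tau) |-> sigma u + tau (d - u)].    *)
Definition oval (o : bool) (s t : nat) : int :=
  let v := (t * (d - u))%N%:Z - (s * u)%N%:Z in if o then v else - v.

Lemma slow_oval k :
  oval (sgn (st k)) (ssig (st k)) (stau (st k)) = (sb (st k))%:Z /\
  oval (~~ sgn (st k)) (salp (st k)) (sbet (st k)) = (sc (st k))%:Z.
Proof.
have le := slow_le; rewrite /oval; elim: k => [|k [IH1 IH2]]; first by split; rewrite /=; lia.
have le_k := le k; rewrite slowS /slow_step; move: (st k) le_k IH1 IH2 => [b c s t s' t' o] /=.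
move: (d - u)%N => e le_k IH1 IH2.
by case: (swaps _) => /=; case: o IH1 IH2 => /= *; split; rewrite ?mulnDl; lia.
Qed.

End Slow.

(** * Blocks of the slow sequence and the Euclidean quotients *)

Section Euclid.
Variables (d u : nat) (p : nat) (a qs ell : nat -> nat).
Hypotheses (u_gt0 : (0 < u)%N) (ud : (2 * u < d)%N) (co_ud : coprime u d).
Hypotheses (heuclid : euclid_data d u p a qs) (hell : euclid_ell p qs ell).
Local Notation st := (slow d u).
Local Notation q := (euclid_q p qs).

(** The index, counted from 0, at which the l-th division starts; for 1 <= l <= p it is m_(l-1) - 1,
    and [block p] is [q]. *)
Definition block l := (\sum_(1 <= j < l) qs j)%N.

Lemma p_gt1 : (1 < p)%N.
Proof.
case: heuclid => a0 a1 _ ap; rewrite ltnNge; apply/negP => p1.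
have : p = 0%N \/ p = 1%N by lia.
by case=> Ep; move: ap; rewrite Ep ?a0 ?a1; lia.
Qed.

Lemma blockS l : (0 < l)%N -> block l.+1 = (block l + qs l)%N.
Proof. by move=> l0; rewrite /block big_nat_recr. Qed.

Lemma a_step l : (0 < l < p)%N ->
  [/\ a l.-1 = (qs l * a l + a l.+1)%N, (a l.+1 < a l)%N & (a l < a l.-1)%N].
Proof.
case: heuclid => a0 a1 H _ /andP [l0 lp].
have Hl i : (0 < i < p)%N -> a i.-1 = (qs i * a i + a i.+1)%N /\ (a i.+1 < a i)%N.
  by move=> Hi; apply: H; lia.
have [E1 E2] := Hl l ltac:(lia); split=> //.
case: l l0 lp E1 E2 => // -[|l] _ lp _ _; first by rewrite /= a0 a1; lia.
by have [] := Hl l.+1 ltac:(lia).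
Qed.

Lemma qs_gt0 l : (0 < l < p)%N -> (0 < qs l)%N.
Proof. by case/a_step => E1 E2 E3; rewrite lt0n; apply/eqP => E; move: E1; rewrite E; lia. Qed.

(** The l-th division is carried out by repeated subtraction of [a l]. The difference first drops
    below [a l] at the last of the [qs l] subtractions, where it equals [a l.+1]; this is the
    swap. *)
Lemma slow_in_block l r : (0 < l < p)%N ->
  sb (st (block l)) = a l.-1 -> sc (st (block l)) = a l -> (r < qs l)%N ->
  [/\ sb (st (block l + r)) = (a l.-1 - r * a l)%N, sc (st (block l + r)) = a l
    & swaps (st (block l + r)) = (r.+1 == qs l)].
Proof.
move=> lp Hb Hc; have [E1 E2 E3] := a_step lp.
have sw i : (i < qs l)%N -> sb (st (block l + i)) = (a l.-1 - i * a l)%N ->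
    sc (st (block l + i)) = a l -> swaps (st (block l + i)) = (i.+1 == qs l).
  move=> lt_i Eb Ec; rewrite /swaps Eb Ec; have : (i.+1 * a l <= qs l * a l)%N.
    by rewrite leq_mul2r lt_i orbT.
  case: eqP => [Ei|/eqP ne_i]; first by rewrite -Ei mulSn in E1; rewrite E1; lia.
  have : (i.+2 * a l <= qs l * a l)%N by rewrite leq_mul2r ltn_neqAle ne_i lt_i orbT.
  by rewrite !mulSn; lia.
elim: r => [|r IH] lt_r.
  by have E := sw _ lt_r; rewrite addn0 mul0n subn0 in E *; split=> //; apply: E.
have [Eb Ec Es] := IH (ltnW lt_r).
have [Eb' Ec'] : sb (st (block l + r.+1)) = (a l.-1 - r.+1 * a l)%N /\
    sc (st (block l + r.+1)) = a l.
  by rewrite addnS slowS /slow_step Es ltn_eqF //= Eb Ec; split=> //; rewrite mulSn; lia.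
by split=> //; apply: sw.
Qed.

Lemma slow_block l : (0 < l <= p)%N ->
  sb (st (block l)) = a l.-1 /\ sc (st (block l)) = a l.
Proof.
case: heuclid => a0 a1 _ _.
elim: l => // -[_ _|l IH lp]; first by rewrite /block big_geq //= a0 a1.
have lp' : (0 < l.+1 < p)%N by lia.
have [/= E1 E2 E3] := a_step lp'.
have [IHb IHc] := IH ltac:(lia).
have q0 := qs_gt0 lp'.
have [|Eb Ec Es] := @slow_in_block l.+1 (qs l.+1).-1 lp' IHb IHc; first by lia.
rewrite blockS // -[qs l.+1](prednK q0) addnS slowS /slow_step Es Eb Ec prednK // eqxx /=.
by rewrite -subnDA -mulSnr prednK // E1 addKn.
Qed.

Lemma block_mono l l' : (l <= l')%N -> (block l <= block l')%N.
Proof.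
elim: l' => [|l' IH]; first by rewrite leqn0 => /eqP ->.
rewrite leq_eqVlt ltnS => /predU1P [->//|/IH le_l].
case: l' le_l {IH} => [|l'] le_l; first by rewrite (leq_trans le_l) // /block !big_geq.
by rewrite blockS // (leq_trans le_l) // leq_addr.
Qed.

Lemma block_uniq k l l' : (block l <= k < block l.+1)%N ->
  (block l' <= k < block l'.+1)%N -> l = l'.
Proof.
move=> /andP [H1 H2] /andP [H3 H4]; case: (ltngtP l l') => // /block_mono; lia.
Qed.

(** The position, counted from 0, of the generator of index m_(ell(n)) for n = k + 1. At [k = q] it
    is the last generator, the one set by convention. *)
Definition mu k := if (k < q)%N then (euclid_m p qs (ell k.+1)).-1 else q.+1.

Lemma ell_block k : (k < q)%N ->
  [/\ (0 < ell k.+1 < p)%N, (block (ell k.+1) <= k < block (ell k.+1).+1)%N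
    & mu k = block (ell k.+1).+1].
Proof.
move=> lt_k; have [/andP [l0 lp]] := @hell k.+1 lt_k.
rewrite /mu lt_k; move: (ell _) l0 lp => l l0 lp; rewrite /euclid_m.
have -> : (l.-1 < p)%N by lia.
rewrite prednK // -/(block l) -/(block l.+1) !add1n ltnS => /andP [H1].
(* The value [l = p] is excluded: it would force [block p <= k], while [block p] is [q]. *)
case: (ltnP l p) => [lt_l|le_l H2]; last first.
  by move: H1; have -> : l = p by [lia]; rewrite leqNgt -/(euclid_q p qs) lt_k.
by rewrite ltnS => H2; split=> //; [apply/andP | apply/andP].
Qed.

Lemma slow_at k : (k < q)%N ->
  (0 < sc (st k))%N /\ swaps (st k) = (k.+1 == mu k).
Proof.
move=> lt_k; have [lp /andP [le_k lt_k'] ->] := ell_block lt_k.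
move: (ell _) lp le_k lt_k' => l lp le_k; have /andP [l0 lt_l] := lp.
have [Hb Hc] := @slow_block l ltac:(lia).
rewrite blockS // -(subnKC le_k) ltn_add2l => lt_r.
have [_ -> ->] := slow_in_block lp Hb Hc lt_r.
by have [_ + _] := a_step lp; rewrite -addnS eqn_add2l => /(leq_ltn_trans (leq0n _)).
Qed.

Lemma euclid_m_mu k : (k < q)%N -> euclid_m p qs (ell k.+1) = (mu k).+1.
Proof.
by case/ell_block => /andP [l0 lp] _ ->; rewrite /euclid_m lp add1n.
Qed.

Lemma mu_gt k : (k < q)%N -> (k < mu k <= q)%N.
Proof.
move=> lt_k; have [/andP [l0 lp] /andP [le_k lt_k'] ->] := ell_block lt_k.
by rewrite lt_k' block_mono.
Qed.

Lemma mu_nonswap k : (k < q)%N -> ~~ swaps (st k) ->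
  mu k = mu k.+1 /\ (k.+1 < mu k)%N.
Proof.
move=> lt_k; have [_ ->] := slow_at lt_k => ne_k.
have /andP [lt_mu le_mu] := mu_gt lt_k.
have lt_k1 : (k.+1 < mu k)%N by rewrite ltn_neqAle ne_k.
split=> //; have [_ H Emu] := ell_block lt_k.
have [_ H' ->] := ell_block (leq_trans lt_k1 le_mu).
rewrite Emu in lt_k1 *; congr (block _.+1); apply: block_uniq H'.
by case/andP: H => H1 H2; rewrite (leq_trans H1).
Qed.

(** After the last block the pair is (gcd, 0), and the gcd is 1 by coprimality. *)
Lemma slow_q : sb (st q) = 1%N /\ sc (st q) = 0%N.
Proof.
have p1 := p_gt1; have [|Eb Ec] := @slow_block p; first by rewrite leqnn andbT; lia.
have c0 : sc (st q) = 0%N by rewrite Ec; case: heuclid.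
split=> //; have := slow_coprime u_gt0 ud q co_ud; rewrite c0 /coprime gcdn0.
by move/eqP.
Qed.

Lemma euclid_q_gt0 : (0 < q)%N.
Proof.
rewrite -[q]/(block p); apply: leq_trans (block_mono p_gt1).
by rewrite blockS // addn_gt0 qs_gt0 ?orbT //= p_gt1.
Qed.

End Euclid.

(** * Lattice vectors of nonnegative degree *)

Section Cones.
Variables (K : fieldType) (d u q : nat).
Local Notation S := (ringS K).
Local Notation st := (slow d u).
Variable J : S -> Prop.
Hypotheses (u_gt0 : (0 < u)%N) (ud : (2 * u < d)%N).
Hypothesis JD : forall f g, J f -> J g -> J (f + g).
Hypothesis JM : forall f g, J g -> J (f * g).
Local Notation Jb o b s t := (J (binom K o b s t)).
Hypothesis J_v : forall k, (k <= q)%N ->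
  Jb (sgn (st k)) (sb (st k)) (ssig (st k)) (stau (st k)).
Hypothesis J_c : forall k, (k <= q)%N ->
  Jb (~~ sgn (st k)) (sc (st k)) (salp (st k)) (sbet (st k)).
Hypothesis c_gt0 : forall k, (k < q)%N -> (0 < sc (st k))%N.
Hypothesis b_q : sb (st q) = 1%N.
Hypothesis c_q : sc (st q) = 0%N.

(** With equal orientations there is no cancellation in the X-monomials, so F_(v+w) = T_0^(b') A'
    F_v + T_1^b B F_w. *)
Lemma binomD o b s t b' s' t' :
  binom K o (b + b') (s + s') (t + t') =
    (tv K 0 ^+ b' * xmon K o s' t') * binom K o b s t +
    (tv K 1 ^+ b * xmon K (~~ o) s t) * binom K o b' s' t'.
Proof. by rewrite /binom !xmonD ![_ ^+ (b + b')]exprD; ring. Qed.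

Lemma binom_ideal_D o b s t b' s' t' :
  Jb o b s t -> Jb o b' s' t' -> Jb o (b + b') (s + s') (t + t').
Proof. by move=> H1 H2; rewrite binomD; apply: JD; apply: JM. Qed.

Lemma binom0 o : binom K o 0 0 0 = 0.
Proof. by rewrite /binom /xmon; case: o; rewrite /= !expr0 !mulr1 subrr. Qed.

Lemma binom_ideal_M n o b s t : Jb o b s t -> Jb o (n * b) (n * s) (n * t).
Proof.
move=> H; elim: n => [|n IH]; last by rewrite !mulSn; apply: binom_ideal_D.
by rewrite !mul0n binom0 -(mul0r (binom K o b s t)); apply: JM.
Qed.

Lemma binom_ideal_N o s t : Jb o 0 s t -> Jb (~~ o) 0 s t.
Proof.
move=> H; have -> : binom K (~~ o) 0 s t = -1 * binom K o 0 s t.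
  by rewrite /binom negbK !expr0 !mul1r mulN1r opprB.
exact: JM.
Qed.

(* Every lattice vector of nonnegative degree is [+- (i v - j gamma)].  With  *)
(* [g = v - gamma], either it lies between [v] and [g], or it is of the same  *)
(* form for the pair [(g, gamma)].                                            *)
Lemma cone_ideal k i j : (k <= q)%N ->
  let: State b c s t s' t' o := st k in
  ((j * c <= i * b)%N -> Jb o (i * b - j * c) (i * s + j * s') (i * t + j * t')) /\
  ((i * b <= j * c)%N -> Jb (~~ o) (j * c - i * b) (i * s + j * s') (i * t + j * t')).
Proof.
move=> le_k; have [n En] : exists n, (k + n = q)%N by exists (q - k)%N; rewrite subnKC.
elim: n k i j En {le_k} => [|n IH] k i j En.
  rewrite addn0 in En; subst k.
  have := J_c (leqnn q); have := J_v (leqnn q); move: b_q c_q.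
  case: (st q) => b c s t s' t' o /= -> -> Hv Hc.
  rewrite !muln0 !muln1 subn0 sub0n leqn0; split=> [_|/eqP ->].
    (* At the end gamma has degree 0, so both gamma and - gamma are available. *)
    have Hn := binom_ideal_N Hc; rewrite negbK in Hn.
    have := binom_ideal_D (binom_ideal_M i Hv) (binom_ideal_M j Hn).
    by rewrite muln1 muln0 addn0.
  by have := binom_ideal_M j Hc; rewrite muln0 !mul0n.
have lt_k : (k < q)%N by lia.
have Hv := J_v (ltnW lt_k); have Hc := J_c (ltnW lt_k).
have c0 := c_gt0 lt_k; have le_cb := slow_le u_gt0 ud k.
have Hv1 := J_v lt_k; have Hc1 := J_c lt_k.
have {IH} IH i' j' := IH k.+1 i' j' ltac:(lia).
rewrite slowS in Hv1 Hc1 IH.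
case: (st k) Hv Hc c0 le_cb Hv1 Hc1 IH => b c s t s' t' o /=; rewrite /slow_step /swaps /=.
move=> Hv Hc c0 le_cb Hv1 Hc1 IH.
have Hg : Jb o (b - c) (s + s') (t + t').

  by case: (b - c < c)%N Hv1 Hc1 => /= Hv1 Hc1; last exact: Hv1; rewrite negbK in Hc1.
have {}IH i' j' :
  ((j' * c <= i' * (b - c))%N ->
     Jb o (i' * (b - c) - j' * c) (i' * (s + s') + j' * s') (i' * (t + t') + j' * t')) /\
  ((i' * (b - c) <= j' * c)%N ->
     Jb (~~ o) (j' * c - i' * (b - c)) (i' * (s + s') + j' * s') (i' * (t + t') + j' * t')).
  case: (b - c < c)%N IH => /= IH; last exact: IH.
  have [H1 H2] := IH j' i'; rewrite negbK in H2.
  by split=> H; rewrite addnC [X in binom _ _ _ _ X]addnC; [apply: H2 | apply: H1].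
have Esub l : (l * (b - c) = l * b - l * c)%N by rewrite mulnBr.
have le_l l : (l * c <= l * b)%N by rewrite leq_mul2l le_cb orbT.
split=> H.
  (* Here i v - j gamma = j g + (i - j) v if j <= i, a sum of equally oriented vectors; otherwise it
     is i g - (j - i) gamma, of the same form for the next pair. As v and gamma have opposite
     orientations, absolute values add in each difference. *)
  case: (leqP j i) => [le_ji|lt_ij].
    have Ei := subnK le_ji; set e := (i - j)%N in Ei.
    have := binom_ideal_D (binom_ideal_M j Hg) (binom_ideal_M e Hv).
    by rewrite -Ei !mulnDl !mulnDr; congr (Jb _ _ _ _); rewrite ?Esub; have := le_l j; lia.
  have [IHa _] := IH i (j - i)%N.
  have Ej := subnK (ltnW lt_ij); move: IHa Ej; set e := (j - i)%N => IHa Ej.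
  move: IHa; rewrite -Ej in H *; rewrite !mulnDl !mulnDr Esub in H * => IHa.
  have le_i := le_l i.
  have -> : (i * b - (e * c + i * c) = i * b - i * c - e * c)%N by lia.
  have -> : (i * s + (e * s' + i * s') = i * s + i * s' + e * s')%N by lia.
  have -> : (i * t + (e * t' + i * t') = i * t + i * t' + e * t')%N by lia.
  by apply: IHa; lia.
have le_ij : (i <= j)%N.
  rewrite leqNgt; apply/negP => lt_ji; have := le_l j.
  have : (j * b < i * b)%N by rewrite ltn_mul2r lt_ji (leq_trans c0).
  lia.
have [_ IHb] := IH i (j - i)%N.
have Ej := subnK le_ij; move: IHb Ej; set e := (j - i)%N => IHb Ej.
move: IHb; rewrite -Ej in H *; rewrite !mulnDl !mulnDr Esub in H * => IHb.
have le_i := le_l i.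
have -> : (e * c + i * c - i * b = e * c - (i * b - i * c))%N by lia.
have -> : (i * s + (e * s' + i * s') = i * s + i * s' + e * s')%N by lia.
have -> : (i * t + (e * t' + i * t') = i * t + i * t' + e * t')%N by lia.
by apply: IHb; lia.
Qed.

(** The initial pair v = (0, 1), gamma = (1, 0) is the standard basis, so t v - s gamma = (- s, t)
    is arbitrary of this orientation. *)
Lemma binom_ideal_true s t : (s * u <= t * (d - u))%N ->
  Jb true (t * (d - u) - s * u) s t.
Proof.
by move=> H; have [+ _] := cone_ideal t s (leq0n q); rewrite !(muln0, muln1, addn0, add0n); apply.
Qed.

Lemma binom_ideal_false s t : (t * (d - u) <= s * u)%N ->
  Jb false (s * u - t * (d - u)) s t.
Proof.
by move=> H; have [_ +] := cone_ideal t s (leq0n q); rewrite !(muln0, muln1, addn0, add0n); apply.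
Qed.

Definition mon5 a b x y z : S :=
  tv K 0 ^+ a * tv K 1 ^+ b * (xv K 0 ^+ x * (xv K 1 ^+ y * xv K 2 ^+ z)).

Lemma mon5_true e s t a b x y z :
  mon5 (a + e) b (x + s) y (z + t) - mon5 a (b + e) x (y + (s + t)) z =
  mon5 a b x y z * binom K true e s t.
Proof. by rewrite /mon5 /binom /xmon /= !exprD; ring. Qed.

Lemma mon5_false e s t a b x y z :
  mon5 (a + e) b x (y + (s + t)) z - mon5 a (b + e) (x + s) y (z + t) =
  mon5 a b x y z * binom K false e s t.
Proof. by rewrite /mon5 /binom /xmon /= !exprD; ring. Qed.

(** The difference of exponents is determined by a lattice vector with entries x' - x and z - z' and
    degree a - a', so [a' <= a] says that this degree is nonnegative. *)
Lemma mon5_ideal a b x y z a' b' x' y' z' : (a' <= a)%N ->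
  (a + d * x + (d - u) * y = a' + d * x' + (d - u) * y')%N ->
  (b + u * y + d * z = b' + u * y' + d * z')%N ->
  (x + y + z = x' + y' + z')%N ->
  J (mon5 a b x y z - mon5 a' b' x' y' z').
Proof.
move=> le_a Ea Eb Ex.
have [w Ew] : exists w, d = (w + u)%N by exists (d - u)%N; rewrite subnK //; lia.
have Ew' : (d - u = w)%N by lia.
rewrite Ew addnK !mulnDl in Ea Eb.
case: (leqP x' x) => [le_x|lt_x].
  have le_z : (z' <= z)%N by nia.
  pose s := (x - x')%N; pose t := (z - z')%N; pose e := (t * w - s * u)%N.
  have Hst : (s * u <= t * w)%N by rewrite /s /t; nia.
  have -> : mon5 a b x y z = mon5 (a' + e) b (x' + s) y (z' + t).
    by congr mon5; rewrite /e /s /t; nia.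
  have -> : mon5 a' b' x' y' z' = mon5 a' (b + e) x' (y + (s + t)) z'.
    by congr mon5; rewrite /e /s /t; nia.
  rewrite mon5_true; apply: JM; rewrite /e -Ew'; apply: binom_ideal_true.
  by rewrite Ew'.
case: (leqP z z') => [le_z|lt_z].
  pose s := (x' - x)%N; pose t := (z' - z)%N; pose e := (s * u - t * w)%N.
  have Hst : (t * w <= s * u)%N by rewrite /s /t; nia.
  have -> : mon5 a b x y z = mon5 (a' + e) b x (y' + (s + t)) z.
    by congr mon5; rewrite /e /s /t; nia.
  have -> : mon5 a' b' x' y' z' = mon5 a' (b + e) (x + s) y' (z + t).
    by congr mon5; rewrite /e /s /t; nia.
  rewrite mon5_false; apply: JM; rewrite /e -Ew'; apply: binom_ideal_false.
  by rewrite Ew'.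
pose s := (x' - x)%N; pose t := (z - z')%N.
pose e := (t * w)%N; pose e' := (s * u)%N.
(* Both entries of the vector are positive here, so it has no single orientation; it is split as (0,
   t) plus (s, 0), passing through an intermediate monomial. *)
have -> : mon5 a b x y z - mon5 a' b' x' y' z' =
    (mon5 (a' + e' + e) b (x + 0) y (z' + t) - mon5 (a' + e') (b + e) x (y + (0 + t)) z') +
    (mon5 (a' + e') (b + e) x (y' + (s + 0)) z' - mon5 a' (b + e + e') (x + s) y' (z' + 0)).
  have -> : (y + (0 + t) = y' + (s + 0))%N by rewrite /s /t; lia.
  rewrite addrA subrK; congr (mon5 _ _ _ _ _ - mon5 _ _ _ _ _);
    rewrite /e /e' /s /t; nia.
rewrite mon5_true mon5_false; apply: JD; apply: JM.
  have := @binom_ideal_true 0 t (leq0n _).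
  by rewrite mul0n subn0 Ew'.
have := @binom_ideal_false s 0 (leq0n _).
by rewrite mul0n subn0.
Qed.

Lemma fibre_ideal (m m' : 'X_{1..2 + 3}) : same_image d u m m' -> J ('X_[m] - 'X_[m']).
Proof.
have H (n n' : 'X_{1..2 + 3}) : (mt n' 0%R <= mt n 0%R)%N -> same_image d u n n' ->
    J ('X_[n] - 'X_[n']).
  move=> le_n /and3P [/eqP E0 /eqP E1 /eqP EX].
  rewrite !XdegE in EX; rewrite !mpolyX5; exact: mon5_ideal.
case: (leqP (mt m' 0%R) (mt m 0%R)) => [/H//|/ltnW /H Hm] /and3P [E0 E1 EX].
have -> : 'X_[m] - 'X_[m'] = -1 * ('X_[m'] - 'X_[m]) :> S by rewrite mulN1r opprB.
by apply/JM/Hm/and3P; split; rewrite eq_sym.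
Qed.

Lemma Phi0_kernel f : Phi0 d u f = 0 -> J f.
Proof.
have J0 : J 0.
  rewrite -(mul0r (binom K (sgn (st 0)) (sb (st 0)) (ssig (st 0)) (stau (st 0)))).
  exact/JM/J_v.
exact: (Phi0_kernel_binomials J0 JD JM fibre_ideal).
Qed.

End Cones.

(** * Bidegrees and minimality *)

Section Bidegree.
Variable K : fieldType.
Local Notation S := (ringS K).
Implicit Types f g : S.
Local Notation Sc := (@S_comp K).

Lemma S_comp0 k l : Sc k l 0.
Proof. by move=> m; rewrite msupp0. Qed.

Lemma S_compD k l f g : Sc k l f -> Sc k l g -> Sc k l (f + g).
Proof. by move=> Hf Hg m /msuppD_le; rewrite mem_cat => /orP [/Hf|/Hg]. Qed.

Lemma S_compN k l f : Sc k l f -> Sc k l (- f).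
Proof. by move=> Hf m; rewrite (perm_mem (msuppN f)) => /Hf. Qed.

Lemma S_compB k l f g : Sc k l f -> Sc k l g -> Sc k l (f - g).
Proof. by move=> Hf Hg; apply/S_compD/S_compN. Qed.

Lemma S_comp_sum k l (I : Type) (r : seq I) (P : pred I) (F : I -> S) :
  (forall i, P i -> Sc k l (F i)) -> Sc k l (\sum_(i <- r | P i) F i).
Proof. by move=> HF; apply: (big_ind (Sc k l)); [apply: S_comp0 | apply: S_compD |]. Qed.

Lemma S_compM k l k' l' f g : Sc k l f -> Sc k' l' g -> Sc (k + k') (l + l') (f * g).
Proof.
move=> Hf Hg m /msuppM_le/allpairsP [[m1 m2] /= [/Hf [<- <-] /Hg [<- <-] ->]].
by rewrite !TdegE !XdegE /mt /mx !mnmDE; split; lia.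
Qed.

Lemma S_compX (m : 'X_{1..2 + 3}) : Sc (Tdeg m) (Xdeg m) 'X_[m].
Proof. by move=> m'; rewrite msuppX inE => /eqP ->. Qed.

Lemma S_comp_cast k l k' l' f : Sc k l f -> k = k' -> l = l' -> Sc k' l' f.
Proof. by move=> Hf <- <-. Qed.

Lemma S_comp_tvX i (n : nat) : Sc n 0 (tv K i ^+ n).
Proof.
rewrite /tv mpolyXn; have := @S_compX (U_(lshift 3 i) *+ n).
rewrite TdegE XdegE /mt /mx !mulmnE !mnmE !eq_lshift !eq_lrshift /= !mul0n !addn0.
suff -> : (((i == 0%R) * n + (i == 1%R) * n)%N = n) by [].
by case: i => [[|[|i]]] //= Hi; rewrite !(mul1n, mul0n, addn0).
Qed.

Lemma S_comp_xvX j (n : nat) : Sc 0 n (xv K j ^+ n).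
Proof.
rewrite /xv mpolyXn; have := @S_compX (U_(rshift 2 j) *+ n).
rewrite TdegE XdegE /mt /mx !mulmnE !mnmE !eq_rshift !eq_rlshift /= !mul0n !addn0.
suff -> : (((j == 0%R) * n + (j == 1%R) * n + (j == 2%R) * n)%N = n) by [].
by case: j => [[|[|[|j]]]] //= Hj; rewrite !(mul1n, mul0n, addn0).
Qed.

Lemma S_comp_xmon o (s t : nat) : Sc 0 (s + t)%N (xmon K o s t).
Proof.
rewrite /xmon; case: o; last exact: S_comp_xvX.
apply: (S_comp_cast (S_compM (@S_comp_xvX 0 s) (@S_comp_xvX 2 t))); lia.
Qed.

Lemma S_comp_tx i (b : nat) o (s t : nat) : Sc b (s + t)%N (tv K i ^+ b * xmon K o s t).
Proof. by apply: (S_comp_cast (S_compM (@S_comp_tvX i b) (@S_comp_xmon o s t))); lia. Qed.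

Lemma S_comp_binom o (b s t : nat) : Sc b (s + t)%N (binom K o b s t).
Proof. by apply: S_compB; apply: S_comp_tx. Qed.

Lemma S_comp_delta k l f (i j : nat) : (i = j -> Sc k l f) -> Sc k l (f * (i == j)%:R).
Proof.
by case: eqP => [E H|_ _]; rewrite ?mulr1 ?mulr0; [apply: H | apply: S_comp0].
Qed.

Lemma lincomb_bihomogeneous m n (f : nat -> 'rV[S]_n)
    (tw : 'I_m -> int * int) (tw' : 'I_n -> int * int) :
  (forall i j, Sc ((tw' j).1 - (tw i).1) ((tw' j).2 - (tw i).2) (entry (f i) j)) ->
  bihomogeneous (free_comp (K := K) tw) (free_comp (K := K) tw') (lincomb f).
Proof.
move=> Hf k l v Hv j; rewrite -entry_ord entry_lincomb; apply: S_comp_sum => i _.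
rewrite entry_ord; apply: (S_comp_cast (S_compM (Hv i) (Hf i j))); ring.
Qed.

Lemma lincomb_bihomogeneous1 m (f : nat -> S^o) (tw : 'I_m -> int * int) :
  (forall i : 'I_m, Sc (- (tw i).1) (- (tw i).2) (f i)) ->
  bihomogeneous (free_comp (K := K) tw) Sc (lincomb f).
Proof.
move=> Hf k l v Hv; apply: S_comp_sum => i _.
apply: (S_comp_cast (S_compM (Hv i) (Hf i))); ring.
Qed.

Local Notation irr := (@irrelevant K).

Lemma irrelevantM f g : irr g -> irr (f * g).
Proof. exact: ideal_genM. Qed.

Lemma irrelevantMl f g : irr f -> irr (f * g).
Proof. by rewrite mulrC; apply: irrelevantM. Qed.

Lemma irrelevantD f g : irr f -> irr g -> irr (f + g).
Proof.
case=> c -> [c' ->]; exists (fun i => c i + c' i); rewrite -big_split.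
by apply: eq_bigr => i _; rewrite mulrDl.
Qed.

Lemma irrelevantB f g : irr f -> irr g -> irr (f - g).
Proof. by move=> Hf Hg; rewrite -mulN1r; apply/irrelevantD/irrelevantM. Qed.

Lemma irrelevantX f n : irr f -> (0 < n)%N -> irr (f ^+ n).
Proof. by move=> Hf; case: n => // n _; rewrite exprS; apply: irrelevantMl. Qed.

Lemma irrelevant_tv i : irr (tv K i).
Proof. exact: (ideal_gen_mem (fun i => 'X_i : S) (lshift 3 i)). Qed.

Lemma irrelevant_xv j : irr (xv K j).
Proof. exact: (ideal_gen_mem (fun i => 'X_i : S) (rshift 2 j)). Qed.

Lemma irrelevant_xmon o s t : (0 < s + t)%N -> irr (xmon K o s t).
Proof.
rewrite /xmon; case: o => st0; last exact: irrelevantX (irrelevant_xv 1) st0.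
case: s st0 => [|s] st0; last by apply/irrelevantMl/irrelevantX => //; apply: irrelevant_xv.
by apply/irrelevantM/irrelevantX => //; apply: irrelevant_xv.
Qed.

Lemma irrelevant_binom o b s t : (0 < s + t)%N -> irr (binom K o b s t).
Proof. by move=> st0; apply: irrelevantB; apply/irrelevantM/irrelevant_xmon. Qed.

End Bidegree.

Lemma Phi0_binom (K : fieldType) (d u : nat) o b s t : (u <= d)%N ->
  oval d u o s t = b%:Z -> Phi0 d u (binom K o b s t) = 0.
Proof.
move=> le_ud Eb; rewrite Phi0B !Phi0M !Phi0Xn !Phi0_tv.
have CX (p : ringR K) n : (p ^+ n)%:P = p%:P ^+ n by exact: polyC_exp.
have H (R : comNzRingType) (x y z : R) e :
    (b + d * s = e * (s + t))%N -> (d * t = b + u * (s + t))%N ->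
    x ^+ b * ((x ^+ d * z) ^+ s * (y ^+ d * z) ^+ t) =
    y ^+ b * (x ^+ e * y ^+ u * z) ^+ (s + t).
  move=> E1 E2; rewrite !exprMn -!exprM E2.
  have -> : x ^+ b * (x ^+ (d * s) * z ^+ s * (y ^+ (b + u * (s + t)) * z ^+ t)) =
    x ^+ (b + d * s) * y ^+ (b + u * (s + t)) * (z ^+ (s + t)) by rewrite !exprD; ring.
  by rewrite E1 !exprD; ring.
have H' (R : comNzRingType) (x y z : R) e :
    (d * s = b + e * (s + t))%N -> (b + d * t = u * (s + t))%N ->
    x ^+ b * (x ^+ e * y ^+ u * z) ^+ (s + t) =
    y ^+ b * ((x ^+ d * z) ^+ s * (y ^+ d * z) ^+ t).
  move=> E1 E2; rewrite !exprMn -!exprM E1.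
  have -> : y ^+ b * (x ^+ (b + e * (s + t)) * z ^+ s * (y ^+ (d * t) * z ^+ t)) =
    x ^+ (b + e * (s + t)) * y ^+ (b + d * t) * (z ^+ (s + t)) by rewrite !exprD; ring.
  by rewrite E2 !exprD; ring.
have [e Ed] : exists e, d = (e + u)%N by exists (d - u)%N; rewrite subnK.
have Ee : (d - u)%N = e by rewrite Ed addnK.
apply/eqP; rewrite subr_eq0; apply/eqP.
rewrite /xmon; case: o Eb => /= Eb; rewrite ?Phi0M !Phi0Xn !Phi0_xv /gens !(tnth_nth 0) /=;
  rewrite [(T0 K ^+ (d - u) * _)%:P]polyCM !CX; [apply: H | apply: H'];
  move: Eb; rewrite /oval Ee; nia.
Qed.

(** * The resolution *)

Section Resolution.
Variables (K : fieldType) (d u p : nat) (a qs ell : nat -> nat).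
Hypotheses (hu : (0 < u)%N) (hud : (2 * u < d)%N) (hgcd : coprime u d).
Hypotheses (heuclid : euclid_data d u p a qs) (hell : euclid_ell p qs ell).
Local Notation S := (ringS K).
Local Notation st := (slow d u).
Local Notation q := (euclid_q p qs).
Local Notation pos := (mu p qs ell).
Local Notation swap := (fun k => swaps (st k)).
Local Notation t0 := (tv K 0).
Local Notation t1 := (tv K 1).

Definition sbs k := sb (st k).
Definition scs k := sc (st k).
Definition mA k := xmon K (sgn (st k)) (ssig (st k)) (stau (st k)).
Definition mB k := xmon K (~~ sgn (st k)) (ssig (st k)) (stau (st k)).
Definition mC k := xmon K (~~ sgn (st k)) (salp (st k)) (sbet (st k)).
Definition mD k := xmon K (sgn (st k)) (salp (st k)) (sbet (st k)).

(** The lattice vectors behind [fv], [fc] and [fd]. Degrees are read from them, and they obey the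
    same step rule, so the position lemmas apply to them as well. *)
Definition vec_v k := (sgn (st k), sb (st k), ssig (st k), stau (st k)).
Definition vec_c k := (~~ sgn (st k), sc (st k), salp (st k), sbet (st k)).
Definition vec_d k :=
  (sgn (st k), sb (st k) - sc (st k), ssig (st k) + salp (st k), stau (st k) + sbet (st k))%N.
Definition vecs := gen q vec_v vec_c.

Definition vbinom (x : bool * nat * nat * nat) : S :=
  let: (o, b, s, t) := x in binom K o b s t.
Definition vdeg (x : bool * nat * nat * nat) : nat := let: (o, b, s, t) := x in b.
Definition vwt (x : bool * nat * nat * nat) : nat := let: (o, b, s, t) := x in (s + t)%N.

Local Notation fv := (Fv t0 t1 sbs mA mB).
Local Notation fc := (Fc t0 t1 scs mC mD).
Local Notation fd := (Fd t0 t1 sbs scs mA mB mC mD).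
Local Notation kap := (kappa swap pos).

Lemma fvE k : fv k = vbinom (vec_v k).
Proof. by []. Qed.

Lemma fcE k : fc k = vbinom (vec_c k).
Proof. by rewrite /= /binom negbK. Qed.

Lemma fdE k : fd k = vbinom (vec_d k).
Proof. by rewrite /= /binom !xmonD. Qed.

Lemma pos_q : pos q = q.+1.
Proof. by rewrite /mu ltnn. Qed.

Lemma pos_gt k : (k < q)%N -> (k < pos k <= q)%N.
Proof. exact: mu_gt hu hud hgcd hell k. Qed.

Lemma vec_step k : (k < q)%N ->
  if swap k then [/\ vec_v k.+1 = vec_c k, vec_c k.+1 = vec_d k & pos k = k.+1]
  else [/\ vec_v k.+1 = vec_d k, vec_c k.+1 = vec_c k & pos k = pos k.+1].
Proof.
move=> lt_k; have [_ Es] := slow_at hu hud hgcd heuclid hell lt_k.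
have Hn := mu_nonswap hu hud hgcd heuclid hell lt_k.
rewrite /vec_v /vec_c /vec_d slowS /slow_step.
case: (swaps (st k)) Es Hn => /= Es Hn; last by split=> //; have [] := Hn isT.
by rewrite negbK; split=> //; apply/esym/eqP; rewrite -Es.
Qed.

Lemma f_step k : (k < q)%N ->
  if swap k then [/\ fv k.+1 = fc k, fc k.+1 = fd k & pos k = k.+1]
  else [/\ fv k.+1 = fd k, fc k.+1 = fc k & pos k = pos k.+1].
Proof.
move=> /vec_step; rewrite !fvE !fcE fdE.
by case: ifP => _ [-> -> ->].
Qed.

Lemma vecs_v k : (k <= q)%N -> vecs k = vec_v k.
Proof. exact: gen_lt. Qed.

Lemma vecs_c k : (k <= q)%N -> vecs (pos k) = vec_c k.
Proof. exact: gen_mu pos_q vec_step k. Qed.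

Lemma vecs_d k : (k < q)%N -> vecs (kap k) = vec_d k.
Proof. exact: gen_kappa pos_q vec_step k. Qed.

Lemma gen_vecs i : gen q fv fc i = vbinom (vecs i).
Proof. by rewrite /gen /vecs /gen fcE; case: ifP. Qed.

Lemma vwt_gt0 i : (0 < vwt (vecs i))%N.
Proof.
by rewrite /vecs /gen; case: ifP => _ /=;
  [have /andP [] := slow_pos d u q | have /andP [] := slow_pos d u i].
Qed.

Lemma seq_b_vecs i : (i < q.+2)%N -> seq_b d u q i.+1 = (vdeg (vecs i))%:Z.
Proof.
move=> lt_i; rewrite /seq_b eqSS /vecs /gen; case: ifP => _.
  by have [_ /= ->] := slow_q hu hud hgcd heuclid.
by rewrite sers_slow.
Qed.

(** The conventional vector (d - u, - u) agrees up to sign with the last gamma: at b = 1, c = 0 the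
    invariant gives |alpha| = d - u and |beta| = u. *)
Lemma absdiff_vecs i : (i < q.+2)%N -> absdiff d u q i.+1 = (vwt (vecs i))%:Z.
Proof.
move=> lt_i; rewrite /absdiff /seq_sigma /seq_tau eqSS /vecs /gen; case: ifP => _.
  have [Eb Ec] := slow_q hu hud hgcd heuclid.
  have [] := slow_invariant hu hud q; rewrite /= Eb Ec; lia.
by rewrite sers_slow // /sers_of /=; case: (sgn _) => /=; lia.
Qed.

Lemma twist1E (i : 'I_q.+2) :
  twist1 d u i = (- (vdeg (vecs i))%:Z, - (vwt (vecs i))%:Z).
Proof. by rewrite /twist1 seq_b_vecs // absdiff_vecs. Qed.

Lemma wmE k : (k < q)%N -> absdiff d u q (euclid_m p qs (ell k.+1)) =
  (salp (st k) + sbet (st k))%N.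
Proof.
move=> lt_k; rewrite (euclid_m_mu hu hud hgcd hell lt_k) absdiff_vecs.
  by rewrite (vecs_c (ltnW lt_k)).
by have /andP [_ /leq_ltn_trans] := pos_gt lt_k; apply; apply: ltnW.
Qed.

Lemma vwt_v k : (k < q)%N -> absdiff d u q k.+1 = (ssig (st k) + stau (st k))%N.
Proof. by move=> lt_k; have lt_k2 := leqW (leqW lt_k); rewrite absdiff_vecs // vecs_v // ltnW. Qed.

Lemma vdeg_v k : (k < q)%N -> seq_b d u q k.+1 = sb (st k).
Proof. by move=> lt_k; have lt_k2 := leqW (leqW lt_k); rewrite seq_b_vecs // vecs_v // ltnW. Qed.

Lemma twist2E (j : 'I_q.*2) : let k := j./2 in
  twist2 d u ell j = (- (sb (st k))%:Z,
    - (ssig (st k) + stau (st k) + (salp (st k) + sbet (st k)))%N%:Z).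
Proof.
have lt_k : (j./2 < q)%N by rewrite ltn_half_double.
by rewrite /twist2 vdeg_v // vwt_v // wmE.
Qed.

Lemma twist3E (k : 'I_q.-1) :
  twist3 d u ell k = (- (sb (st k))%:Z,
    - (ssig (st k) + stau (st k) + 2 * (salp (st k) + sbet (st k)))%N%:Z).
Proof.
have lt_k : (k < q)%N by have := ltn_ord k; lia.
by rewrite /twist3 vdeg_v // vwt_v // wmE // PoszD PoszM.
Qed.

Local Notation G1 := (gen q fv fc).
Local Notation G2 := (syz q t0 t1 sbs scs mA mB mC mD swap pos).
Local Notation G3 := (ssyz q t0 t1 scs mC mD swap).
Local Notation phi1 := (@lincomb S q.+2 S^o G1).
Local Notation phi2 := (@lincomb S q.*2 'rV[S]_q.+2 G2).
Local Notation phi3 := (@lincomb S q.-1 'rV[S]_q.*2 G3).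

Lemma phi1_bihomogeneous : bihomogeneous
  (free_comp (K := K) (twist1 d u (p := p) (qs := qs))) (@S_comp K) phi1.
Proof.
apply: lincomb_bihomogeneous1 => i; rewrite twist1E /= !opprK gen_vecs.
by case: (vecs i) => [[[o b] s] t]; apply: S_comp_binom.
Qed.

Lemma entry_syz j i : (j < q.*2)%N -> let k := j./2 in
  entry (G2 j) i = if odd j then
    mD k * (k == i)%:R - t0 ^+ scs k * (kap k == i)%:R
      - t1 ^+ (sbs k - scs k) * mB k * (pos k == i)%:R
  else
    mC k * (k == i)%:R - t1 ^+ scs k * (kap k == i)%:R
      - t0 ^+ (sbs k - scs k) * mA k * (pos k == i)%:R.
Proof.
move=> lt_j k; have lt_k : (k < q)%N by rewrite ltn_half_double.
have lt_ka : (kap k < q.+2)%N by have /andP [] := kappa_bound swap pos_q pos_gt lt_k.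
have lt_po : (pos k < q.+2)%N by have /andP [_ /leq_ltn_trans] := pos_gt lt_k; apply; lia.
have lt_k2 : (k < q.+2)%N by lia.
by rewrite /syz -/k; case: ifP => _; rewrite !entryB !entryZ !entry_evec.
Qed.

Lemma sb_sc k : (sc (st k) <= sb (st k))%N.
Proof. exact: slow_le. Qed.

Lemma phi2_bihomogeneous : bihomogeneous (free_comp (K := K) (twist2 d u ell))
  (free_comp (K := K) (twist1 d u (p := p) (qs := qs))) phi2.
Proof.
apply: lincomb_bihomogeneous => j i; rewrite twist2E twist1E entry_syz //=.
have lt_k : (j./2 < q)%N by rewrite ltn_half_double.
move: (j./2) lt_k => k lt_k; have le_cb := sb_sc k.
by case: ifP => _; (apply: S_compB; first apply: S_compB); apply: S_comp_delta => <-;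
  rewrite ?vecs_c ?vecs_d ?vecs_v ?(ltnW lt_k) //=;
  [ apply: (S_comp_cast (@S_comp_xmon K _ _ _))
  | apply: (S_comp_cast (@S_comp_tvX K _ _))
  | apply: (S_comp_cast (@S_comp_tx K _ _ _ _ _))
  | apply: (S_comp_cast (@S_comp_xmon K _ _ _))
  | apply: (S_comp_cast (@S_comp_tvX K _ _))
  | apply: (S_comp_cast (@S_comp_tx K _ _ _ _ _)) ];
  rewrite /scs /sbs; lia.
Qed.

Lemma entry_ssyz k j : (k < q.-1)%N ->
  entry (G3 k) j = t0 ^+ scs k.+1 * (k.+1.*2 == j)%:R - t1 ^+ scs k.+1 * (k.+1.*2.+1 == j)%:R
    - (-1) ^+ swaps (st k) * (mD k * (k.*2 == j)%:R - mC k * (k.*2.+1 == j)%:R).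
Proof.
move=> lt_k; have [h1 h2] : (k < q)%N /\ (k.+1 < q)%N by lia.
by rewrite /ssyz !entryB !entryZ !entryB !entryZ !entry_evec ?ltn_double ?ltn_Sdouble.
Qed.

Lemma S_comp_sign (e : nat) k l (f : S) : S_comp k l f -> S_comp k l ((-1) ^+ e * f).
Proof.
move=> Hf; elim: e => [|e IH]; first by rewrite mul1r.
by rewrite exprS -mulrA mulN1r; apply: S_compN.
Qed.

(** These identities make [ssyz k] homogeneous: its parts from step [k.+1] and from step [k] have
    the same bidegree. *)
Lemma slow_succ k : (sb (st k.+1) + sc (st k.+1) = sb (st k))%N /\
  (ssig (st k.+1) + stau (st k.+1) + (salp (st k.+1) + sbet (st k.+1)) =
   ssig (st k) + stau (st k) + 2 * (salp (st k) + sbet (st k)))%N.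
Proof.
have := sb_sc k; rewrite slowS /slow_step; case: (st k) => b c s t s' t' o /= le_cb.
by case: (swaps _) => /=; lia.
Qed.

Lemma phi3_bihomogeneous : bihomogeneous (free_comp (K := K) (twist3 d u ell))
  (free_comp (K := K) (twist2 d u ell)) phi3.
Proof.
apply: lincomb_bihomogeneous => k j; rewrite twist3E twist2E entry_ssyz //=.
have [E1 E2] := slow_succ k.
have Ej l : (l.*2 == j) || (l.*2.+1 == j) -> j./2 = l.
  by case/orP => /eqP <-; rewrite /= ?uphalf_double ?doubleK.
apply: S_compB; [apply: S_compB | apply: S_comp_sign; apply: S_compB];
  apply: S_comp_delta => E.
- rewrite (Ej k.+1) ?E ?eqxx //.
  by apply: (S_comp_cast (@S_comp_tvX K _ _)); rewrite /scs; lia.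
- rewrite (Ej k.+1) ?E ?eqxx ?orbT //.
  by apply: (S_comp_cast (@S_comp_tvX K _ _)); rewrite /scs; lia.
- rewrite (Ej k) ?E ?eqxx //.
  by apply: (S_comp_cast (@S_comp_xmon K _ _ _)); lia.
- rewrite (Ej k) ?E ?eqxx ?orbT //.
  by apply: (S_comp_cast (@S_comp_xmon K _ _ _)); lia.
Qed.

Lemma delta_evec n (i : 'I_n) : delta_mx 0 i = evec S n i :> 'rV[S]_n.
Proof. by apply/rowP => j; rewrite !mxE eqxx. Qed.

Lemma scs_gt0 k : (k < q)%N -> (0 < scs k)%N.
Proof. by case/(slow_at hu hud hgcd heuclid hell). Qed.

Lemma phi1_minimal (i : 'I_q.+2) : irrelevant (phi1 (delta_mx 0 i)).
Proof.
rewrite delta_evec lincomb_evec // gen_vecs; have := vwt_gt0 i.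
by case: (vecs i) => [[[o b] s] t]; apply: irrelevant_binom.
Qed.

Lemma irrelevant_tpow i k : (k < q)%N -> irrelevant (tv K i ^+ scs k).
Proof. by move=> lt_k; apply: irrelevantX (irrelevant_tv K i) (scs_gt0 lt_k). Qed.

(** The exponent [b - c] may be 0, so the entry at [pos k] is covered by its X-monomial, of positive
    degree, and the one at [kap k] by [c > 0]. *)
Lemma phi2_minimal (f : {linear 'rV[S]_q.*2 -> 'rV[S]_q.+2}) : f =1 phi2 ->
  forall i j, irrelevant (lin1_mx f i j).
Proof.
move=> Ef i j; rewrite mxE Ef delta_evec lincomb_evec // -entry_ord entry_syz //.
have lt_k : (i./2 < q)%N by rewrite ltn_half_double.
move: (i./2) lt_k => k lt_k; have /andP [H1 H2] := slow_pos d u k.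
by case: ifP => _; (apply: irrelevantB; first apply: irrelevantB); apply: irrelevantMl;
  by [apply: irrelevant_xmon | apply: irrelevant_tpow
     | apply: irrelevantM; apply: irrelevant_xmon].
Qed.

Lemma phi3_minimal (f : {linear 'rV[S]_q.-1 -> 'rV[S]_q.*2}) : f =1 phi3 ->
  forall i j, irrelevant (lin1_mx f i j).
Proof.
move=> Ef i j; rewrite mxE Ef delta_evec lincomb_evec // -entry_ord entry_ssyz //.
(* Strictness matters: [ssyz i] contains powers T^c with c taken at step [i.+1], and c vanishes at
   [q]. *)
have lt_k : (i.+1 < q)%N by have := ltn_ord i; lia.
have /andP [_ H2] := slow_pos d u i.
apply: irrelevantB; [|apply: irrelevantM]; apply: irrelevantB; apply: irrelevantMl;
  by [apply: irrelevant_tpow | apply: irrelevant_xmon].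
Qed.

Lemma saturating_mD k : saturating t0 t1 (mD k).
Proof. by move=> c f b b'; apply: xmon_saturated. Qed.

Lemma fd_regular k f h : (k < q)%N -> f * fd k = h * fc k -> exists h', f = h' * fc k.
Proof.
move=> lt_k; rewrite fdE fcE; apply: binom_regular; first exact: scs_gt0.
  by have /andP [H1 H2] := slow_pos d u k; rewrite addnACA addn_gt0 H1.
by have /andP [] := slow_pos d u k.
Qed.

Lemma fv_regular f h : f * fv 0 = h * fc 0 -> exists h', f = h' * fc 0.
Proof. by rewrite fvE fcE; apply: binom_regular. Qed.

Lemma fc0_neq0 : fc 0 != 0.
Proof. by apply: tdiff_neq0; rewrite ?xmon_neq0 ?univ_t_xmon. Qed.

Lemma bs_cs k : (k < q)%N -> (scs k <= sbs k)%N.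
Proof. by move=> _; apply: sb_sc. Qed.

Let q0 := euclid_q_gt0 hu hud hgcd heuclid.

Lemma phi1_exact_at : exact_at phi2 phi1.
Proof.
move=> v; split=> [|[w <-]].
  exact: (phi1_exact q0 (tv_neq0 K 0) (tv_neq0 K 1) bs_cs f_step pos_q pos_gt
    saturating_mD fd_regular fv_regular fc0_neq0).
exact: (phi12 bs_cs f_step pos_q pos_gt).
Qed.

Lemma phi2_exact_at : exact_at phi3 phi2.
Proof.
move=> v; split=> [|[w <-]].
  exact: (phi2_exact q0 (tv_neq0 K 0) (tv_neq0 K 1) bs_cs f_step pos_q pos_gt
    (@tpow_syzygy K) fc0_neq0).
exact: (phi23 q0 (tv_neq0 K 0) (tv_neq0 K 1) bs_cs f_step pos_q fc0_neq0).
Qed.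

Lemma phi3_injective : injective phi3.
Proof.
exact: (phi3_inj q0 (tv_neq0 K 0) (tv_neq0 K 1) pos_q fc0_neq0).
Qed.

Lemma Phi0_gen i : (i < q.+2)%N -> Phi0 d u (G1 i) = 0.
Proof.
move=> lt_i; rewrite gen_vecs /vecs /gen; have le_ud : (u <= d)%N by lia.
by case: ifP => _; apply: Phi0_binom => //;
  [have [] := slow_oval hu hud q | have [] := slow_oval hu hud i].
Qed.

Lemma Phi0_exact_at : exact_at phi1 (@Phi0 K d u).
Proof.
move=> f; split=> [|[v <-]]; last first.
  rewrite /lincomb Phi0_sum big1 // => i _.
  by rewrite -[_ *: _]/(v 0 i * G1 i) Phi0M Phi0_gen ?mulr0.
have [Eb Ec] := slow_q hu hud hgcd heuclid.
pose J (g : S) := exists v, phi1 v = g.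
apply: (@Phi0_kernel K d u q J hu hud _ _ _ _ scs_gt0 Eb Ec) => [_ _ [v <-] [w <-]|g _ [v <-]|k le_k|k le_k].
- by exists (v + w); rewrite linearD.
- by exists (g *: v); rewrite linearZ.
- exists (evec S q.+2 k); rewrite lincomb_evec ?gen_vecs ?vecs_v //.
  exact: leqW.
exists (evec S q.+2 (pos k)); rewrite lincomb_evec ?gen_vecs ?vecs_c //.
by have /andP [] := mu_bound pos_q pos_gt le_k.
Qed.

End Resolution.

Theorem theorem2p1 (K : fieldType) (d u : nat)
    (hu : (0 < u)%N) (hd : (0 < d)%N) (hud : (2 * u < d)%N)
    (hgcd : coprime u d)
    (p : nat) (a qs ell : nat -> nat)
    (heuclid : euclid_data d u p a qs) (hell : euclid_ell p qs ell) :
  let S := ringS K in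
  let q := euclid_q p qs in
  exists (Phi3 : {linear 'rV[S]_q.-1 -> 'rV[S]_(q.*2)})
         (Phi2 : {linear 'rV[S]_(q.*2) -> 'rV[S]_q.+2})
         (Phi1 : {linear 'rV[S]_q.+2 -> S^o}),
    let F3 := free_comp (K := K) (twist3 d u ell) in
    let F2 := free_comp (K := K) (twist2 d u ell) in
    let F1 := free_comp (K := K) (twist1 d u (p := p) (qs := qs)) in
    (* the maps are homogeneous of bidegree (0, 0) *)
    [/\ bihomogeneous F3 F2 Phi3,
        bihomogeneous F2 F1 Phi2,
        bihomogeneous F1 (@S_comp K) Phi1
      & bihomogeneous (@S_comp K) (@RZ_comp K d) (@Phi0 K d u)] /\
    (* exactness *)
    [/\ injective Phi3,
        exact_at Phi3 Phi2,
        exact_at Phi2 Phi1,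
        exact_at Phi1 (@Phi0 K d u)
      & forall f : ringRZ K, Rees d u f <-> exists s : S, Phi0 d u s = f] /\
    (* minimality *)
    [/\ forall i j, irrelevant (lin1_mx Phi3 i j),
        forall i j, irrelevant (lin1_mx Phi2 i j)
      & forall i, irrelevant (Phi1 (delta_mx 0 i))].
Proof.
move=> S q.
pose G1 := gen q (Fv (tv K 0) (tv K 1) (sbs d u) (mA K d u) (mB K d u))
  (Fc (tv K 0) (tv K 1) (scs d u) (mC K d u) (mD K d u)).
pose G2 := syz q (tv K 0) (tv K 1) (sbs d u) (scs d u)
  (mA K d u) (mB K d u) (mC K d u) (mD K d u) (fun k => swaps (slow d u k)) (mu p qs ell).
pose G3 := ssyz q (tv K 0) (tv K 1) (scs d u) (mC K d u) (mD K d u)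
  (fun k => swaps (slow d u k)).
pose Phi3 : {linear 'rV[S]_q.-1 -> 'rV[S]_(q.*2)} := @lincomb S q.-1 'rV[S]_q.*2 G3.
pose Phi2 : {linear 'rV[S]_(q.*2) -> 'rV[S]_q.+2} := @lincomb S q.*2 'rV[S]_q.+2 G2.
have E3 : Phi3 =1 @lincomb S q.-1 'rV[S]_q.*2 G3 by [].
have E2 : Phi2 =1 @lincomb S q.*2 'rV[S]_q.+2 G2 by [].
exists Phi3, Phi2, (@lincomb S q.+2 S^o G1) => F3 F2 F1.
split; [split|split; split].
- exact: phi3_bihomogeneous hu hud hgcd heuclid hell.
- exact: phi2_bihomogeneous hu hud hgcd heuclid hell.
- exact: phi1_bihomogeneous hu hud hgcd heuclid.
- by apply: Phi0_bihomogeneous; lia.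
- exact: phi3_injective hu hud hgcd heuclid.
- exact: phi2_exact_at hu hud hgcd heuclid hell.
- exact: phi1_exact_at hu hud hgcd heuclid hell.
- exact: Phi0_exact_at hu hud hgcd heuclid hell.
- exact: Rees_image.
- exact: (phi3_minimal hu hud hgcd heuclid hell E3).
- exact: (phi2_minimal hu hud hgcd heuclid hell E2).
- exact: phi1_minimal.
Qed.
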